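(* Consider the controlled particle $\dot{\vec r}=\vec v$, $\dot{\vec v}=\vec f+\vec d+\vec u$ in $\mathbb{R}^3$, with $\vec h=\vec r\times\vec v\neq 0$ and $\vec r\neq 0$ along the motion. Let $\hat h_d$ be a constant unit vector (desired angular momentum direction) with RTN components $h_{dR},h_{dT},h_{dN}$, and assume that the angle $\beta$ between $\hat h$ and $\hat h_d$ (defined by $\cos\beta=\hat h\cdot\hat h_d$) satisfies $\beta<90^\circ$. Assume that the disturbance component normal to the orbit, $d_N$, is bounded as $|d_N|<D_N$. Let $\lambda_N>0$ and $K_N\ge D_N$. Then the control normal to the osculating plane $$u_N=\frac{h^2}{r^3h_{dN}}\left(h_{dR}-\lambda_N h_{dT}\right)-K_N\,\mathrm{sgn}(s_N)-f_N$$ guarantees convergence to the sliding surface $$s_N=\hat h_d\cdot(\lambda_N\hat r+\hat\theta)=h_{dT}+\lambda_N h_{dR}=0,$$ and, once this surface is reached, the osculating plane asymptotically converges to the desired plane defined by $\hat h_d$ (i.e. $\hat h\to\hat h_d$ as $t\to\infty$).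
   Context: The equations of motion are written in a reference frame centered at the point to be orbited: $\vec r(t),\vec v(t)\in\mathbb{R}^3$ are position and velocity, $\vec f(\vec r,\vec v,t)$ is a known smooth nonlinear function, $\vec d(\vec r,\vec v,t)$ is an unknown disturbance, and $\vec u(\vec r,\vec v,t)$ is the control. Write $r=\|\vec r\|$, $h=\|\vec h\|$. The radial-transverse-normal (RTN) frame is the orthonormal frame $$\hat r=\vec r/r,\qquad \hat h=\vec h/h,\qquad \hat\theta=\hat h\times\hat r .$$ For any vector $\vec A$, its RTN components are $A_R=\vec A\cdot\hat r$, $A_T=\vec A\cdot\hat\theta$, $A_N=\vec A\cdot\hat h$; thus $f_N,d_N,u_N$ are the normal components of $\vec f,\vec d,\vec u$, and $h_{dR}=\hat h_d\cdot\hat r$, $h_{dT}=\hat h_d\cdot\hat\theta$, $h_{dN}=\hat h_d\cdot\hat h$. The osculating plane is the plane through the origin spanned by $\vec r$ and $\vec v$, with unit normal $\hat h$. $\mathrm{sgn}$ is the sign function; solutions of the discontinuous closed loop are understood in the usual sliding-mode (Filippov) sense. ''Once reached'' means that the motion stays on $s_N=0$ from some time on.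
   Formalization: Both limits fail in general; s_N→0 is proved if ∫(r/h)h_dN(K_N−|d_N|)dt=∞, and ĥ→ĥ_d if ∫h/r² dt=∞. Without these only strict decrease of |s_N|, invariance of s_N=0 and decrease of β are claimed. d is taken continuous in the state, u locally bounded. *)

(* Defs.v *)
From HB Require Import structures.
From mathcomp Require Import all_boot all_order all_algebra.
From mathcomp Require Import all_classical all_reals all_analysis.

Set Implicit Arguments.
Unset Strict Implicit.
Unset Printing Implicit Defensive.

Import Order.TTheory GRing.Theory Num.Theory.
Import numFieldNormedType.Exports.

Local Open Scope classical_set_scope.
Local Open Scope ring_scope.

(* The library norm `| u | on 'rV[R]_3 is the sup norm; it is used below only
   in notions that do not depend on the choice of a norm.  Lengths of vectors
   are [enorm]. *)
Definition dot (R : realType) (u v : 'rV[R]_3) : R := (u *m v^T) 0 0.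

Definition enorm (R : realType) (u : 'rV[R]_3) : R := Num.sqrt (dot u u).

(* Indices are added in 'I_3, that is, modulo 3. *)
Definition cross (R : realType) (u v : 'rV[R]_3) : 'rV[R]_3 :=
  \row_(i < 3) (u 0 (i + 1) * v 0 (i + 2) - u 0 (i + 2) * v 0 (i + 1)).

(* States (r, v): position and velocity. *)
Notation state R := ('rV[R]_3 * 'rV[R]_3)%type.

Section rtn.
Variable R : realType.
Implicit Types (x : state R) (A hd : 'rV[R]_3).

Definition ang_mom x : 'rV[R]_3 := cross x.1 x.2.

Definition rhat x : 'rV[R]_3 := (enorm x.1)^-1 *: x.1.
Definition hhat x : 'rV[R]_3 := (enorm (ang_mom x))^-1 *: ang_mom x.
Definition thetahat x : 'rV[R]_3 := cross (hhat x) (rhat x).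

Definition compR x A : R := dot A (rhat x).
Definition compT x A : R := dot A (thetahat x).
Definition compN x A : R := dot A (hhat x).

Definition beta hd x : R := acos (dot (hhat x) hd).

(* The states at which the RTN frame is defined. *)
Definition rtn_defined : set (state R) :=
  [set x | x.1 != 0 /\ ang_mom x != 0].

Definition sN (lambdaN : R) hd x : R :=
  dot hd (lambdaN *: rhat x + thetahat x).

Definition normal_law (lambdaN KN : R) hd (f : state R -> R -> 'rV[R]_3)
    x (t : R) : R :=
  enorm (ang_mom x) ^+ 2 / (enorm x.1 ^+ 3 * compN x hd)
    * (compR x hd - lambdaN * compT x hd)
  - KN * Num.sg (sN lambdaN hd x) - compN x (f x t).

Definition closed_loop (f d u : state R -> R -> 'rV[R]_3) x (t : R) : state R :=
  (x.2, f x t + d x t + u x t).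

End rtn.

Section smooth.
Variables (R : realType) (V W : normedModType R).

(* Class C^k on a set U, meant for open U and finite-dimensional V. *)
Fixpoint Ck_on (k : nat) (U : set V) (F : V -> W) : Prop :=
  match k with
  | 0 => forall x, U x -> {for x, continuous F}
  | k'.+1 => (forall x, U x -> differentiable F x) /\
             (forall w : V, Ck_on k' U (fun x => 'D_w F x))
  end.

Definition smooth_on (U : set V) (F : V -> W) := forall k, Ck_on k U F.

End smooth.

Section filippov.
Variable R : realType.

(* Lebesgue-null subsets of R^6: balls of [state R] are open cubes, and the one
   of radius rho k has volume (2 * rho k)^6. *)
Definition null_set (N : set (state R)) : Prop :=
  forall e : R, 0 < e ->
    exists (c : nat -> state R) (rho : nat -> R),
      [/\ forall k, 0 < rho k,
          N `<=` \bigcup_k ball (c k) (rho k)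
        & (\sum_(0 <= k <oo) ((2 * rho k) ^+ 6)%:E <= e%:E)%E].

Definition closed_convex_hull (V : normedModType R) (A : set V) : set V :=
  \bigcap_(C in [set C : set V | [/\ closed C, convex_set C & A `<=` C]]) C.

Definition filippov (F : state R -> R -> state R) (x : state R) (t : R) :
    set (state R) :=
  \bigcap_(delta in [set delta : R | 0 < delta]) \bigcap_(N in null_set)
    closed_convex_hull ((F ^~ t) @` (ball x delta `\` N)).

Definition abs_continuous (V : normedModType R) (a b : R) (g : R -> V) : Prop :=
  forall e : R, 0 < e -> exists2 delta : R, 0 < delta &
    forall (n : nat) (p q : 'I_n -> R),
      (forall i, [/\ a <= p i, p i <= q i & q i <= b]) ->
      (forall i j, i != j -> q i <= p j \/ q j <= p i) ->
      \sum_(i < n) (q i - p i) < delta ->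
      \sum_(i < n) `|g (q i) - g (p i)| < e.

(* Filippov solutions of x' = F(x, t) on [t0, +oo[. *)
Definition filippov_solution (F : state R -> R -> state R) (t0 : R)
    (x : R -> state R) : Prop :=
  (forall b, t0 <= b -> abs_continuous t0 b x) /\
  {ae lebesgue_measure, forall t : R, t0 < t ->
    derivable x t 1 /\ filippov F (x t) t (derive1 x t)}.

End filippov.

(* Main.v *)
Require Import Defs.
From HB Require Import structures.
From mathcomp Require Import all_boot all_order all_algebra.
From mathcomp Require Import all_classical all_reals all_analysis.
From mathcomp Require Import measurable_realfun ring lra.

Import Order.TTheory GRing.Theory Num.Theory.
Import numFieldNormedType.Exports.

Local Open Scope classical_set_scope.
Local Open Scope ring_scope.

(* Let a_N be the normal component of the acceleration.  Since
     rhat' = (h / r^2) thetahat,   hhat' = - (r a_N / h) thetahat,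
   the feedback law yields s' = (r / h) h_dN (d_N - K_N sgn s) wherever s <> 0:
   there the closed loop is a continuous function of the state in the direction
   hhat, up to a term that vanishes in the limit because u is locally bounded,
   so all Filippov velocities share the same a_N.  Hence s^2 is nonincreasing,
   also through s = 0, where a_N is undetermined but (s^2)' = 2 s s' = 0.  If s
   never vanishes then |s|' <= - (r / h) h_dN (K_N - |d_N|), whose integral must
   stay bounded by |s(t0)|.  On the surface, s' = 0 determines a_N, and
   q = 1 - h_dN^2 satisfies q' = - 2 lambda_N (h / r^2) q.

   The solutions being only absolutely continuous, all of this rests on the
   fact that an absolutely continuous function whose derivative is nonpositive
   almost everywhere is nonincreasing. *)

Set Implicit Arguments.
Unset Strict Implicit.
Unset Printing Implicit Defensive.

(** * Absolutely continuous functions *)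

Section absolute_continuity.
Context {R : realType}.
Implicit Types a b : R.

(** Sums, products, inverses and square roots all reduce to this bound on increments. Two dominating
    functions allow for products; a constant in one slot gives the unary cases. *)
Lemma abs_continuous_dominated (V1 V2 W : normedModType R) a b C
    (f : R -> V1) (g : R -> V2) (F : R -> W) :
  abs_continuous a b f -> abs_continuous a b g ->
  (forall u v, a <= u -> u <= v -> v <= b ->
     `|F v - F u| <= C * (`|f v - f u| + `|g v - g u|)) ->
  abs_continuous a b F.
Proof.
move=> acf acg FC e e0.
have C0 : 0 < `|C| + 1 by rewrite ltr_wpDl.
(* [|C| + 1] is positive and bounds [C] whatever the sign of [C]; each of the two sums gets half of
   [e]. *)
have e20 : 0 < e / 2 / (`|C| + 1) by rewrite !divr_gt0.
have [d1 d10 f1] := acf _ e20.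
have [d2 d20 g2] := acg _ e20.
exists (Num.min d1 d2); first by rewrite lt_min d10.
move=> n p q pq dis; rewrite lt_min => /andP[s1 s2].
have {}f1 := f1 n p q pq dis s1; have {}g2 := g2 n p q pq dis s2.
apply: (@le_lt_trans _ _ (\sum_(i < n) (`|C| + 1) *
  (`|f (q i) - f (p i)| + `|g (q i) - g (p i)|))).
  apply: ler_sum => i _; have [ap pqi qb] := pq i.
  apply: (le_trans (FC _ _ ap pqi qb)); apply: ler_wpM2r; first exact: addr_ge0.
  by rewrite (le_trans (ler_norm C))// lerDl.
rewrite -mulr_sumr big_split/= -ltr_pdivlMl// (_ : _ * e = e / 2 / (`|C| + 1)
  + e / 2 / (`|C| + 1)); first by rewrite ltrD.
by field; rewrite gt_eqF.
Qed.

Lemma abs_continuous_sub (V : normedModType R) a b a' b' (f : R -> V) :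
  a <= a' -> b' <= b -> abs_continuous a b f -> abs_continuous a' b' f.
Proof.
move=> aa bb acf e /acf[d d0 H]; exists d => // n p q pq; apply: H => i.
have [? ? ?] := pq i; split=> //; lra.
Qed.

(** A family made of the single interval between [t] and [u] turns the definition into continuity
    relative to [[a, b]]. *)
Lemma abs_continuous_ball (V : normedModType R) a b (f : R -> V) t e :
  abs_continuous a b f -> 0 < e -> a <= t <= b ->
  exists2 d, 0 < d & forall u, a <= u <= b -> `|u - t| < d -> `|f u - f t| < e.
Proof.
move=> acf e0 tab; have [d d0 H] := acf _ e0; exists d => // u uab ut.
have [tu|tu] := leP t u.
- have := H 1 (fun=> t) (fun=> u); rewrite !big_ord1; apply.
  + by move=> _; split=> //; move/andP: tab; move/andP: uab; lra.
  + by move=> i j; rewrite !ord1.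
  + by rewrite ger0_norm in ut; lra.
- rewrite distrC; have := H 1 (fun=> u) (fun=> t); rewrite !big_ord1; apply.
  + by move=> _; split; move/andP: tab; move/andP: uab; lra.
  + by move=> i j; rewrite !ord1.
  + by rewrite ltr0_norm in ut; lra.
Qed.

Lemma abs_continuous_within (V : normedModType R) a b (f : R -> V) :
  abs_continuous a b f -> {within `[a, b], continuous f}.
Proof.
move=> acf; apply/subspace_continuousP => t; rewrite /= in_itv/= => tab.
apply/cvgrPdist_lt => e e0; have [d d0 H] := abs_continuous_ball acf e0 tab.
rewrite near_withinE.
have : \forall u \near t, `|t - u| < d by exists d.
apply: filterS => u tu; rewrite /= in_itv/= => uab.
by rewrite distrC; apply: H => //; rewrite distrC.
Qed.

Lemma abs_continuous_bounded a b (f : R -> R) :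
  abs_continuous a b f -> exists M, forall t, a <= t <= b -> `|f t| <= M.
Proof.
move=> acf; have [ab|ab] := leP a b; last first.
  by exists 0 => t /andP[at_ tb]; lra.
have cf := abs_continuous_within acf.
have [c _ fc] := EVT_max ab cf; have [c' _ fc'] := EVT_min ab cf.
exists (`|f c| + `|f c'|) => t tab.
have tI : t \in `[a, b] by rewrite in_itv.
rewrite ler_norml; apply/andP; split.
  by have := fc' _ tI; have := ler_norm (- f c'); rewrite normrN; have := normr_ge0 (f c); lra.
by have := fc _ tI; have := ler_norm (f c); have := normr_ge0 (f c'); lra.
Qed.

Lemma abs_continuous_pos_lbound a b (f : R -> R) :
  abs_continuous a b f -> (forall t, a <= t <= b -> 0 < f t) ->
  exists2 m, 0 < m & forall t, a <= t <= b -> m <= f t.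
Proof.
move=> acf f0; have [ab|ab] := leP a b; last first.
  by exists 1 => // t /andP[at_ tb]; lra.
have [c cI fc] := EVT_min ab (abs_continuous_within acf).
by exists (f c) => [|t tab]; [apply: f0; rewrite in_itv in cI|apply: fc; rewrite in_itv].
Qed.

Lemma abs_continuous_cst (V : normedModType R) a b (c : V) :
  abs_continuous a b (fun=> c).
Proof.
move=> e e0; exists 1 => // n p q _ _ _.
by rewrite big1// => i _; rewrite subrr normr0.
Qed.

Lemma abs_continuous_id a b : abs_continuous a b (fun t : R => t).
Proof.
move=> e e0; exists e => // n p q pq _ s.
rewrite (eq_bigr (fun i => q i - p i)) // => i _; have [_ ? _] := pq i.
by rewrite ger0_norm// subr_ge0.
Qed.

Lemma abs_continuousD a b (f g : R -> R) :
  abs_continuous a b f -> abs_continuous a b g ->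
  abs_continuous a b (fun t => f t + g t).
Proof.
move=> acf acg; apply: (@abs_continuous_dominated _ _ _ _ _ 1 _ _ _ acf acg).
move=> u v _ _ _; rewrite mul1r (_ : _ - _ = (f v - f u) + (g v - g u)) ?ler_normD//.
by ring.
Qed.

Lemma abs_continuousM a b (f g : R -> R) :
  abs_continuous a b f -> abs_continuous a b g ->
  abs_continuous a b (fun t => f t * g t).
Proof.
move=> acf acg.
have [M fM] := abs_continuous_bounded acf.
have [N gN] := abs_continuous_bounded acg.
apply: (@abs_continuous_dominated _ _ _ _ _ (`|M| + `|N|) _ _ _ acf acg).
move=> u v au uv vb.
have fv : `|f v| <= `|M| + `|N|.
  by apply: (le_trans (fM v _)); [lra|rewrite (le_trans (ler_norm _))// lerDl].
have gu : `|g u| <= `|M| + `|N|.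
  by apply: (le_trans (gN u _)); [lra|rewrite (le_trans (ler_norm _))// lerDr].
rewrite (_ : _ - _ = (f v - f u) * g u + f v * (g v - g u)); last by ring.
rewrite (le_trans (ler_normD _ _))// !normrM mulrDr lerD//.
  by rewrite mulrC ler_wpM2r.
by rewrite ler_wpM2r.
Qed.

Lemma abs_continuousN a b (f : R -> R) :
  abs_continuous a b f -> abs_continuous a b (fun t => - f t).
Proof.
move=> acf; rewrite (_ : (fun t => - f t) = (fun t => (-1) * f t)).
  by apply: abs_continuousM => //; exact: abs_continuous_cst.
by apply/funext => t; rewrite mulN1r.
Qed.

(** By compactness the values stay above some [m > 0], and inversion is Lipschitz there with
    constant [m ^- 2]. *)
Lemma abs_continuousV a b (f : R -> R) :
  abs_continuous a b f -> (forall t, a <= t <= b -> 0 < f t) ->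
  abs_continuous a b (fun t => (f t)^-1).
Proof.
move=> acf f0; have [m m0 fm] := abs_continuous_pos_lbound acf f0.
apply: (@abs_continuous_dominated _ _ _ _ _ (m ^- 2) _ _ _ acf
  (@abs_continuous_cst R a b 0)).
move=> u v au uv vb; rewrite subrr normr0 addr0.
have mu : m <= f u by apply: fm; lra.
have mv : m <= f v by apply: fm; lra.
have fu0 : 0 < f u by lra.
have fv0 : 0 < f v by lra.
rewrite (_ : _ - _ = (f u * f v)^-1 * (f u - f v)); last first.
  by field; rewrite !gt_eqF.
rewrite normrM (distrC (f u)) ler_wpM2r// ger0_norm; last first.
  by rewrite invr_ge0 mulr_ge0// ltW.
by rewrite lef_pV2 ?posrE ?exprn_gt0 ?mulr_gt0// expr2 ler_pM// ltW.
Qed.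

Lemma abs_continuous_sqrt a b (f : R -> R) :
  abs_continuous a b f -> (forall t, a <= t <= b -> 0 < f t) ->
  abs_continuous a b (fun t => Num.sqrt (f t)).
Proof.
move=> acf f0; have [m m0 fm] := abs_continuous_pos_lbound acf f0.
apply: (@abs_continuous_dominated _ _ _ _ _ ((Num.sqrt m)^-1) _ _ _ acf
  (@abs_continuous_cst R a b 0)).
move=> u v au uv vb; rewrite subrr normr0 addr0.
have mu : m <= f u by apply: fm; lra.
have mv : m <= f v by apply: fm; lra.
have sm0 : 0 < Num.sqrt m by rewrite sqrtr_gt0.
have su : Num.sqrt m <= Num.sqrt (f u) by rewrite ler_wsqrtr.
have sv : Num.sqrt m <= Num.sqrt (f v) by rewrite ler_wsqrtr.
rewrite ler_pdivlMl//.
have -> : f v - f u = (Num.sqrt (f v) + Num.sqrt (f u)) * (Num.sqrt (f v) - Num.sqrt (f u)).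
  rewrite -[in LHS](@sqr_sqrtr _ (f v)); last lra.
  by rewrite -[in LHS](@sqr_sqrtr _ (f u)); [ring|lra].
rewrite normrM ler_wpM2r// ger0_norm; lra.
Qed.

End absolute_continuity.

(** * Monotonicity from the sign of the derivative almost everywhere *)

Section monotonicity.
Context {R : realType}.
Implicit Types a b : R.

(** Multiplying the difference quotient estimate by [|y - t|] makes it hold at [y = t] too, on both
    sides of [t] at once. *)
Lemma derivable_increment (F : R -> R) t e : derivable F t 1 -> 0 < e ->
  exists2 eta, 0 < eta & forall y, `|y - t| < eta ->
    `|F y - F t - derive1 F t * (y - t)| <= e * `|y - t|.
Proof.
move=> /cvgrPdist_lt/(_ e) dF e0; rewrite derive1E.
have [eta /= eta0 H] := dF e0.
exists eta => // y yt; have [->|ynt] := eqVneq y t.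
  by rewrite !subrr mulr0 subr0 normr0 mulr0.
have yt0 : y - t != 0 by rewrite subr_eq0.
have := H (y - t); rewrite /= sub0r normrN => /(_ yt yt0).
have -> : (y - t)%:A + t = y by rewrite -[X in X + _]/((y - t) * 1) mulr1 subrK.
rewrite -/('D_1 F t) -[(y - t)^-1 *: _]/((y - t)^-1 * (F y - F t)) => /ltW Hy.
rewrite (_ : F y - F t - _ = - (y - t) * ('D_1 F t - (y - t)^-1 * (F y - F t))).
  by rewrite normrM normrN mulrC ler_wpM2r.
by field.
Qed.

(* Cover the exceptional set by an open set U of measure less than d.  Then
   [F c - F a] exceeds [e1 * (c - a)] by at most the variation of F over finitely
   many disjoint intervals inside U; the supremum of the c for which this holds
   is b. *)
Lemma abs_continuous_ae_nonincreasing a b (F : R -> R) : a <= b ->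
  abs_continuous a b F ->
  {ae lebesgue_measure, forall t : R, a < t < b ->
     derivable F t 1 /\ derive1 F t <= 0} ->
  F b <= F a.
Proof.
move=> ab acF [A [mA A0 PA]]; apply/ler_addgt0Pr => e e0.
(* The share [b - a] of the denominator pays for the slope error over [[a, b]], the share 1 for the
   variation of [F] inside [U]. *)
pose e1 := e / (b - a + 1).
have e10 : 0 < e1 by rewrite divr_gt0//; lra.
have [d d0 Fd] := acF _ e10.
(* The endpoints join the exceptional set, since the derivative is controlled on the open interval
   only. *)
pose A' := A `|` [set a] `|` [set b].
have mA' : measurable A' by do 2 (apply: measurableU => //).
have A'0 : lebesgue_measure A' = 0%E.
  have h1 (c : R) (B : set R) : measurable B -> lebesgue_measure B = 0%E ->
      lebesgue_measure (B `|` [set c]) = 0%E.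
    move=> mB B0; apply/eqP; rewrite eq_le measure_ge0 andbT.
    have := measureU2 (@lebesgue_measure R) mB (measurable_set1 c).
    move=> /le_trans; apply.
    by rewrite [X in (X + _)%E]B0 [X in (_ + X)%E]lebesgue_measure_set1 adde0.
  by apply: (h1 b); [exact: measurableU|exact: (h1 a)].
have [U [oU AU Ud]] : exists U : set R, [/\ open U, A' `<=` U & (lebesgue_measure U < d%:E)%E].
  have [|U [oU AU Ud]] := lebesgue_regularity_outer mA' _ d0.
    by rewrite [X in (X < _)%E]A'0.
  exists U; split=> //; apply: le_lt_trans Ud.
  have mU := open_measurable oU.
  rewrite -{1}(setDUK AU); apply: (le_trans (measureU2 _ mA' (measurableD mU mA'))).
  by rewrite [X in (X + _)%E]A'0 add0e.
have mU := open_measurable oU.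
have mUI c : measurable (U `&` `[a, c[) by exact: measurableI.
(* The chosen intervals are compared with [U] through their total length only, which is what
   absolute continuity asks for. They are listed from left to right, so that a new one is appended
   at the end. *)
pose P c := a <= c <= b /\ exists n (p q : nat -> R),
  [/\ forall i, (i < n)%N -> [/\ a <= p i, p i <= q i & q i <= c],
      forall i j, (i < j)%N -> (j < n)%N -> q i <= p j,
      ((\sum_(i < n) (q i - p i))%:E <= lebesgue_measure (U `&` `[a, c[))%E &
      F c - F a <= e1 * (c - a) + \sum_(i < n) `|F (q i) - F (p i)|].
(* [P] can be carried across any [t]. If [t] is in [U], the interval [[u, v]] lies in [U] and is
   added to the list; otherwise the first-order expansion at [t] bounds [F v - F u] by
   [e1 * (v - u)]. *)
have loc t : a <= t <= b -> exists2 eta, 0 < eta & forall u v,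
    a <= u -> u <= t -> t <= v -> v <= b -> t - u < eta -> v - t < eta ->
    P u -> P v.
  move=> tab; have [Ut|nUt] := pselect (U t).
    have /nbhs_ballP[eta /= eta0 tU] : nbhs t U by exact: open_nbhs_nbhs.
    exists eta => // u v au ut tv vb tu vt [_ [n [p [q [pq dis mn Fn]]]]].
    split; first by lra.
    exists n.+1, (fun i => if (i < n)%N then p i else u),
      (fun i => if (i < n)%N then q i else v).
    have sumE (G : nat -> nat -> R) (H1 H2 : nat -> R) (y z : R) (K : R -> R -> R) :
        \sum_(i < n.+1) K (if (i < n)%N then H1 i else y) (if (i < n)%N then H2 i else z)
        = \sum_(i < n) K (H1 i) (H2 i) + K y z.
      rewrite big_ord_recr/= ltnn; congr (_ + _).
      by apply: eq_bigr => i _; rewrite ltn_ord.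
    split.
    - move=> i _; case: ifPn => [/pq[? ? ?]|_]; split=> //; lra.
    - move=> i j ij; rewrite ltnS leq_eqVlt => /orP[/eqP jn|jn].
        by rewrite jn ltnn -jn ij; have [|_ _] := pq i; [rewrite -jn|].
      by rewrite jn (ltn_trans ij jn); exact: dis.
    - rewrite (sumE (fun _ _ => 0) q p v u (fun x y => x - y)) EFinD.
      apply: (@le_trans _ _ (lebesgue_measure ((U `&` `[a, u[) `|` `[u, v[))).
        rewrite [leRHS](measureU (@lebesgue_measure R) (mUI u)
          (measurable_itv `[u, v[)); last first.
          apply/seteqP; split => // z [[_ /=]]; rewrite !in_itv/= => /andP[_ zu].
          by move=> /andP[uz _]; lra.
        apply: leeD => //; rewrite [X in (_ <= X)%E]lebesgue_measure_itv/= lte_fin.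
        have [uv|vu] := ltP u v.
          by rewrite -EFinD.
        by rewrite lee_fin subr_le0.
      apply: le_measure; rewrite ?inE; [|exact: mUI|].
        by apply: measurableU; [exact: mUI|exact: measurable_itv].
      move=> z [[Uz]|]; rewrite /= !in_itv/= => /andP[z1 z2]; split=> //.
      + lra.
      + apply: tU; rewrite /ball/= ltr_norml; lra.
      + lra.
    - rewrite (sumE (fun _ _ => 0) q p v u (fun x y => `|F x - F y|)).
      have := ler_norm (F v - F u); have : e1 * (u - a) <= e1 * (v - a).
        by rewrite ler_wpM2l//; lra.
      lra.
  have [t1 t2] : derivable F t 1 /\ derive1 F t <= 0.
    have nA't : ~ A' t by move=> /AU.
    have atb : a < t < b.
      apply/andP; split; rewrite lt_neqAle; apply/andP; split; try lra.
        by apply/eqP => ta; apply: nA't; left; right.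
      by apply/eqP => ta; apply: nA't; right.
    have : ~ (~` [set x | a < x < b -> derivable F x 1 /\ derive1 F x <= 0]) t.
      by move=> /PA At; apply: nA't; left; left.
    by move/contrapT; exact.
  have [eta eta0 Ft] := derivable_increment t1 e10.
  exists eta => // u v au ut tv vb tu vt [_ [n [p [q [pq dis mn Fn]]]]].
  split; first by lra.
  exists n, p, q; split=> //.
  - by move=> i /pq[? ? ?]; split=> //; lra.
  - apply: (le_trans mn); apply: le_measure; rewrite ?inE; [exact: mUI|exact: mUI|].
    move=> z [Uz /=]; rewrite !in_itv/= => ?; split=> //; lra.
  - have := Ft u; rewrite ler0_norm ?subr_le0// opprB => /(_ tu).
    rewrite ler_norml => /andP[Fu _].
    have := Ft v; rewrite ger0_norm ?subr_ge0// => /(_ vt).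
    rewrite ler_norml => /andP[_ Fv].
    have : derive1 F t * (v - t) <= 0 by rewrite mulr_le0_ge0// subr_ge0.
    have : 0 <= derive1 F t * (u - t) by rewrite mulr_le0// subr_le0.
    move: Fu Fv Fn; rewrite !mulrBr; lra.
pose S : set R := P.
have Pa : P a.
  split; first by lra.
  exists 0%N, (fun=> 0), (fun=> 0); split=> //.
  - by rewrite big_ord0 measure_ge0.
  - by rewrite !big_ord0; lra.
have ubS : ubound S b by move=> c [/andP[]].
have supS : has_sup S by split; [exists a|exists b].
have mab : a <= sup S <= b.
  apply/andP; split; first by apply: ub_le_sup => //; exact: supS.2.
  by apply: ge_sup => //; exact: supS.1.
(* Crossing the supremum from a nearby element of [S] either reaches [b] or yields an element of [S]
   beyond the supremum. *)
have [eta eta0 H] := loc _ mab.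
have [u Su um] := sup_adherent eta0 supS.
have [_ [n [p [q [pq dis mn Fn]]]]] : P b.
  have us : u <= sup S by apply: ub_le_sup => //; exact: supS.2.
  have au : a <= u by case: Su => /andP[].
  have [bm|bm] := leP b (sup S + eta / 2).
    apply: (H u b) => //; lra.
  have : sup S + eta / 2 <= sup S.
    apply: ub_le_sup; first exact: supS.2.
    apply: (H u) => //; lra.
  lra.
have sd : \sum_(i < n) (q i - p i) < d.
  rewrite -lte_fin; apply: (le_lt_trans mn); apply: le_lt_trans Ud.
  by apply: le_measure; rewrite ?inE; [exact: mUI| |exact: subIsetl].
have := Fd n (p \o val) (q \o val); rewrite /= => /(_ _ _ sd) H1.
have {}H1 : \sum_(i < n) `|F (q i) - F (p i)| < e1.
  apply: H1 => [i|i j]; first by apply: pq.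
  rewrite -val_eqE/=; case: ltngtP => // ij _.
    by left; apply: dis.
  by right; apply: dis.
have e1E : e1 * (b - a) + e1 = e by rewrite /e1; field; rewrite gt_eqF//; lra.
lra.
Qed.

End monotonicity.

(** * Integrals controlled by a differential inequality *)

Section integral_bound.
Context {R : realType}.
Notation mu := (@lebesgue_measure R).
Import HBNNSimple HBSimple.

Lemma measure_itv_lty (b1 b2 : bool) (u v : R) :
  (mu [set` Interval (BSide b1 u) (BSide b2 v)] < +oo)%E.
Proof. by rewrite lebesgue_measure_itv/=; case: ifP; rewrite ?ltry// -EFinB ltry. Qed.

Lemma integrable_cst_itv (b1 b2 : bool) (u v c : R) :
  mu.-integrable [set` Interval (BSide b1 u) (BSide b2 v)] (EFin \o cst c).
Proof.
apply: measurable_bounded_integrable; first exact: measurable_itv.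
- exact: measure_itv_lty.
- exact: measurable_cst.
exists `|c|; split; first exact: num_real.
by move=> M cM x _ /=; apply: ltW.
Qed.

Lemma Rintegral_cst_itv (b1 b2 : bool) (u v c : R) : u <= v ->
  \int[mu]_(t in [set` Interval (BSide b1 u) (BSide b2 v)]) c = c * (v - u).
Proof.
move=> uv; rewrite Rintegral_cst; last exact: measurable_itv.
rewrite [X in _ * fine X]lebesgue_measure_itv/= lte_fin.
have [_|vu] := ltP u v; first by rewrite -EFinB.
by rewrite (_ : v = u) ?subrr//; lra.
Qed.

Section bounded_integrand.
Variables (h : R -> R) (C : R).
Hypotheses (mh : measurable_fun setT h) (h0C : forall x, 0 <= h x <= C).

Lemma integrable_bounded (A : set R) : measurable A -> (mu A < +oo)%E ->
  mu.-integrable A (EFin \o h).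
Proof.
move=> mA Afin; apply: measurable_bounded_integrable => //.
  exact: measurable_funS mh.
exists C; split; first exact: num_real.
by move=> M CM x _ /=; have /andP[h0 hC] := h0C x; rewrite ger0_norm; lra.
Qed.

Lemma integrable_bounded_itv (b1 b2 : bool) (u v : R) :
  mu.-integrable [set` Interval (BSide b1 u) (BSide b2 v)] (EFin \o h).
Proof.
apply: integrable_bounded; first exact: measurable_itv.
exact: measure_itv_lty.
Qed.

Let H a b := (\int[mu]_(t in `[a, b]) h t).

Lemma Rintegral_increment a u v : a <= u -> u <= v ->
  0 <= H a v - H a u <= C * (v - u).
Proof.
move=> au uv; rewrite /H Rintegral_itvB; [|exact: integrable_bounded_itv| |]; last 2 first.
- by rewrite bnd_simp.
- by rewrite bnd_simp.
apply/andP; split; first by apply: Rintegral_ge0 => x _; case/andP: (h0C x).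
apply: (@le_trans _ _ (\int[mu]_(t in `]u, v]) C)).
  apply: le_Rintegral => //.
  - exact: integrable_bounded_itv.
  - exact: integrable_cst_itv.
  - by move=> x _; case/andP: (h0C x).
by rewrite Rintegral_cst_itv.
Qed.

(** Boundedness of the integrand makes the primitive Lipschitz with constant [C], so the identity
    serves as dominating function. *)
Lemma abs_continuous_Rintegral a u v : a <= u -> abs_continuous u v (H a).
Proof.
move=> au; have acid := @abs_continuous_id R u v.
apply: (@abs_continuous_dominated _ _ _ _ _ _ C _ _ _ acid acid).
move=> x y ux xy yv; have ax : a <= x by lra.
have /andP[H1 H2] := Rintegral_increment ax xy.
rewrite ger0_norm// (le_trans H2)//.
have C0 : 0 <= C by have := h0C 0; lra.
rewrite ler_wpM2l// ger0_norm ?subr_ge0// lerDl subr_ge0//.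
Qed.

Lemma derive_Rintegral_ae a :
  {ae mu, forall t, a < t -> derivable (H a) t 1 /\ derive1 (H a) t = h t}.
Proof.
have lh : locally_integrable setT h.
  split=> //; first exact: openT.
  move=> K _ cK; have mK : measurable K by exact: compact_measurable.
  by have /integrableP[_] := integrable_bounded mK (compact_finite_measure cK).
have := FTC1 (fun y => integrable_bounded_itv true false a y) lh.
apply: filterS; first exact: (ae_filter_ringOfSetsType mu).
by move=> t H1 at_; apply: H1.
Qed.


End bounded_integrand.

(** Monotone convergence along the intervals [[t0, t0 + n]]. As the bound is given from [T] on, each
    interval is enlarged to end at or after [T]. *)
Lemma integral_itvcy_le (h : R -> R) (t0 T B : R) :
  measurable_fun setT h -> (forall x, 0 <= h x) ->
  (forall b, T <= b -> (\int[mu]_(t in `[t0, b]) (h t)%:E <= B%:E)%E) ->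
  (\int[mu]_(t in `[t0, +oo[) (h t)%:E <= B%:E)%E.
Proof.
move=> mh h0 hB.
rewrite itv_bndy_bigcup_BRight.
have cv : (\int[mu]_(x in `[t0, (t0 + n%:R)%R]) (h x)%:E)%E @[n --> \oo] -->
    (\int[mu]_(x in \bigcup_n `[t0, (t0 + n%:R)%R]%classic) (h x)%:E)%E.
  have := @ge0_nondecreasing_set_cvg_integral _ (measurableTypeR R) R
    (fun n : nat => `[t0, t0 + n%:R]%classic) (EFin \o h) (@lebesgue_measure R).
  apply.
  - move=> m n mn; apply/subsetPset/subset_itvl.
    by rewrite bnd_simp lerD2l ler_nat.
  - by move=> n; exact: measurable_itv.
  - by move=> n; apply/measurable_EFinP; exact: measurable_funS mh.
  - by move=> n x _; rewrite lee_fin.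
rewrite -(cvg_lim (@ereal_hausdorff R) cv); apply: lime_le; first exact: cvgP cv.
apply: nearW => n; apply: (le_trans _ (hB (Num.max T (t0 + n%:R)) _)).
  apply: ge0_subset_integral => //=.
  - by apply/measurable_EFinP; exact: measurable_funS mh.
  - by move=> x _; rewrite lee_fin.
  - by apply: subset_itvl; rewrite bnd_simp le_max lexx orbT.
by rewrite le_max lexx.
Qed.

(* The function g need not be measurable: its integral is a supremum over the
   simple functions below it, and FTC1 is applied to each of those. *)
Lemma integral_itvcy_lt_pinfty (g F : R -> R) (t0 T M k : R) : t0 <= T -> 0 < k ->
  (forall t, t0 <= t -> 0 <= g t) ->
  (forall t, t0 <= t <= T -> g t <= M) ->
  (forall t, T <= t -> 0 <= F t) ->
  (forall b, T <= b -> abs_continuous T b F) ->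
  {ae mu, forall t, T < t -> derivable F t 1 /\ derive1 F t <= - (k * g t)} ->
  (\int[mu]_(t in `[t0, +oo[) (g t)%:E < +oo)%E.
Proof.
move=> t0T k0 g0 gM F0 acF dF.
(* [M * (T - t0)] bounds the integral up to [T]; [F T / k] bounds the rest, because the nonnegative
   [F] can lose at most [F T]. *)
pose B := M * (T - t0) + F T / k.
apply: (@le_lt_trans _ _ B%:E); last by rewrite ltry.
rewrite ge0_integralE; last first.
  by move=> x /=; rewrite in_itv/= andbT lee_fin => /g0.
apply: ge_ereal_sup => _ [h /= hg <-].
have mh : measurable_fun setT h by exact: measurable_funPT.
have h0 x : 0 <= h x by exact: fun_ge0.
have hle t : t0 <= t -> h t <= g t.
  move=> tt; have := hg t; rewrite patchE ifT ?lee_fin//.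
  by rewrite inE/= in_itv/= tt.
have hz t : ~~ (t0 <= t) -> h t = 0.
  move=> tt; have := hg t; rewrite patchE ifF ?lee_fin//.
    by move=> ht; apply/eqP; rewrite eq_le ht h0.
  by apply/negbTE; rewrite notin_setE/= in_itv/= andbT; apply/negP.
have -> : sintegral mu h = (\int[mu]_(t in `[t0, +oo[) (h t)%:E)%E.
  rewrite integral_nnsfun//; congr sintegral; apply/funext => t; rewrite patchE.
  case: ifPn => //; rewrite notin_setE/= in_itv/= andbT => /negP tt.
  by rewrite hz.
have [C h0C] : exists C, forall x, 0 <= h x <= C.
  have [M' [_ hM]] := simple_bounded h; exists (M' + 1) => x.
  rewrite h0/= -[h x]ger0_norm//; apply: hM => //; first by rewrite ltrDl.
apply: (@integral_itvcy_le _ _ T) => // b Tb.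
pose H b := (\int[mu]_(t in `[t0, b]) h t).
have ih := integrable_bounded_itv mh h0C.
rewrite -[leLHS]fineK; last first.
  by apply: integrable_fin_num; [exact: measurable_itv|exact: (ih true false)].
rewrite -/(Rintegral _ _ _) -/(H b) lee_fin.
have HT : H T <= M * (T - t0).
  apply: (@le_trans _ _ (\int[mu]_(t in `[t0, T]) M)).
    apply: le_Rintegral; first exact: measurable_itv.
      exact: (ih true false).
      exact: integrable_cst_itv.
    move=> x; rewrite /= in_itv/= => xI; apply: (le_trans (hle _ _)); last exact: gM.
    by case/andP: xI.
  by rewrite Rintegral_cst_itv.
(* Beyond [T] the sum has derivative [k * h + F'] almost everywhere, which is at most
   [k * (h - g) <= 0]. *)
have : k * H b + F b <= k * H T + F T.
  apply: (@abs_continuous_ae_nonincreasing R T b (fun t => k * H t + F t)) => //.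
    apply: abs_continuousD; last exact: acF.
    apply: abs_continuousM; first exact: abs_continuous_cst.
    exact: (abs_continuous_Rintegral mh h0C).
  apply: (@filterS2 _ _ (ae_filter_ringOfSetsType mu) _ _ _ _ dF
    (derive_Rintegral_ae mh h0C t0)) => t dFt dHt /andP[Tt tb].
  have [dF1 dF2] := dFt Tt.
  have [dH1 dH2] := dHt (le_lt_trans t0T Tt).
  have dH : is_derive t 1 (H : R -> R) (h t).
    by apply: DeriveDef => //; rewrite -derive1E.
  have dF' : is_derive t 1 (F : R -> R) (derive1 F t).
    by apply: DeriveDef => //; rewrite -derive1E.
  have dHF : is_derive t 1 (fun t => k * H t + F t) (k * h t + derive1 F t).
    by apply: is_deriveD.
  split; first by have [] := dHF.
  rewrite derive1E derive_val.
  have : k * h t <= k * g t by rewrite ler_wpM2l ?hle//; lra.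
  lra.
move=> HF; rewrite /B -(ler_pM2l k0) mulrDr [k * (F T / k)]mulrC divfK ?gt_eqF//.
have : k * H T <= k * (M * (T - t0)) by rewrite ler_wpM2l// ltW.
have := F0 _ Tb; lra.
Qed.

End integral_bound.
(** * Kinematics of the RTN frame *)

Section vectors.
Context {R : realType}.
Implicit Types (u v w : 'rV[R]_3) (c : R).

Lemma dotE u v : dot u v = u 0 0 * v 0 0 + u 0 1 * v 0 1 + u 0 2 * v 0 2.
Proof.
rewrite /dot !mxE !big_ord_recl big_ord0 addr0 addrA !mxE.
by congr (_ * _ + _ * _ + _ * _); congr (_ _ _); apply: val_inj.
Qed.

Lemma crossE u v :
  (cross u v 0 0 = u 0 1 * v 0 2 - u 0 2 * v 0 1) *
  (cross u v 0 1 = u 0 2 * v 0 0 - u 0 0 * v 0 2) *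
  (cross u v 0 2 = u 0 0 * v 0 1 - u 0 1 * v 0 0).
Proof.
by do !split; rewrite !mxE; congr (_ * _ - _ * _); congr (_ _ _); apply: val_inj.
Qed.

Lemma I3_cases (i : 'I_3) : [\/ i = 0, i = 1 | i = 2].
Proof.
case: i => -[|[|[|//]]] i3.
- by apply: Or31; apply: val_inj.
- by apply: Or32; apply: val_inj.
- by apply: Or33; apply: val_inj.
Qed.

Lemma dotC u v : dot u v = dot v u.
Proof. by rewrite !dotE; ring. Qed.

Lemma dotDl u v w : dot (u + v) w = dot u w + dot v w.
Proof. by rewrite !dotE !mxE; ring. Qed.

Lemma dotDr u v w : dot u (v + w) = dot u v + dot u w.
Proof. by rewrite !dotE !mxE; ring. Qed.

Lemma dotBr u v w : dot u (v - w) = dot u v - dot u w.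
Proof. by rewrite !dotE !mxE; ring. Qed.

Lemma dotZl c u v : dot (c *: u) v = c * dot u v.
Proof. by rewrite !dotE !mxE; ring. Qed.

Lemma dotZr c u v : dot u (c *: v) = c * dot u v.
Proof. by rewrite !dotE !mxE; ring. Qed.

Lemma crossvv u : cross u u = 0.
Proof. by apply/rowP => i; rewrite !mxE; ring. Qed.

Lemma dot_ge0 u : 0 <= dot u u.
Proof. by rewrite dotE -!expr2 !addr_ge0// sqr_ge0. Qed.

Lemma dot_eq0 u : dot u u = 0 -> u = 0.
Proof.
rewrite dotE -!expr2 => u0.
have h0 := sqr_ge0 (u 0 0); have h1 := sqr_ge0 (u 0 1).
have h2 := sqr_ge0 (u 0 2).
apply/rowP => i; rewrite mxE; apply/eqP; rewrite -sqrf_eq0; apply/eqP.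
by case: (I3_cases i) => ->; lra.
Qed.

Lemma sqr_enorm u : enorm u ^+ 2 = dot u u.
Proof. by rewrite sqr_sqrtr// dot_ge0. Qed.

Lemma dot_gt0 u : u != 0 -> 0 < dot u u.
Proof.
move=> u0; rewrite lt_neqAle dot_ge0 andbT eq_sym.
by apply: contra_neq u0; exact: dot_eq0.
Qed.

Lemma enorm_gt0 u : u != 0 -> 0 < enorm u.
Proof. by move=> u0; rewrite sqrtr_gt0 dot_gt0. Qed.

Lemma sqr_coord_le u i : u 0 i ^+ 2 <= dot u u.
Proof.
rewrite dotE -!expr2.
have h0 := sqr_ge0 (u 0 0); have h1 := sqr_ge0 (u 0 1).
have h2 := sqr_ge0 (u 0 2).
by case: (I3_cases i) => ->; lra.
Qed.

(** The expansion of the vector triple product; with [u] the position and [v] the velocity it is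
    [r ^ 3] times the component of [rhat'] along [w]. *)
Lemma dot_cross_cross w u v :
  dot w (cross (cross u v) u) = dot w v * dot u u - dot u v * dot w u.
Proof. by rewrite !dotE !crossE; ring. Qed.

Lemma dot_cross_self u v : dot u (cross u v) = 0.
Proof. by rewrite !dotE !crossE; ring. Qed.

(* Gram determinant *)
Lemma sqr_triple w u v : dot w (cross u v) ^+ 2 =
  dot w w * (dot u u * dot v v - dot u v ^+ 2)
  - dot w u * (dot w u * dot v v - dot u v * dot w v)
  + dot w v * (dot w u * dot u v - dot u u * dot w v).
Proof. by rewrite !dotE !crossE; ring. Qed.

(** With [h = cross r v] and [h' = cross r a], the left side is [|h| ^ 3] times the component along
    [w] of the derivative of [h / |h|]. *)
Lemma angular_acceleration_transverse w r v a :
  dot (cross r v) (cross r v) * dot w (cross r a)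
  - dot (cross r v) (cross r a) * dot w (cross r v) =
  - dot a (cross r v) * dot w (cross (cross r v) r).
Proof. by rewrite !dotE !crossE; ring. Qed.

(** The contribution of [hhat'] to [thetahat'], up to the factor [|h| ^ 3 * |r|]. *)
Lemma angular_acceleration_normal w r v a :
  dot (cross r v) (cross r v) * dot w (cross (cross r a) r)
  - dot (cross r v) (cross r a) * dot w (cross (cross r v) r) =
  dot r r * dot a (cross r v) * dot w (cross r v).
Proof. by rewrite !dotE !crossE; ring. Qed.

(** The contribution of [rhat'] to [thetahat'], up to the factor [|h| * |r| ^ 3]. *)
Lemma transverse_rotation w r v :
  dot r r * dot w (cross (cross r v) v) - dot r v * dot w (cross (cross r v) r) =
  - dot (cross r v) (cross r v) * dot w r.
Proof. by rewrite !dotE !crossE; ring. Qed.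

End vectors.

(** * Derivatives and absolute continuity of vector-valued curves *)

Section curves.
Context {R : realType}.
Implicit Types (u v : R -> 'rV[R]_3) (du dv : 'rV[R]_3) (f g : R -> R) (t : R).

(** A continuous linear form passes through the limit of difference quotients; this transfers the
    derivative of the state curve to its coordinates. *)
Lemma is_derive_continuous_linear (V : normedModType R) (L : V -> R)
    (X : R -> V) t :
  continuous L -> (forall y z, L (y - z) = L y - L z) ->
  (forall c y, L (c *: y) = c * L y) ->
  derivable X t 1 -> is_derive t (1 : R) (fun s => L (X s)) (L (derive1 X t)).
Proof.
move=> cL LB LZ dX.
have cv : h^-1 *: (L (X (h *: (1 : R) + t)) - L (X t)) @[h --> 0^'] --> L (derive1 X t).
  rewrite (_ : (fun h => _) = L \o (fun h : R => h^-1 *: (X (h *: (1 : R) + t) - X t))).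
    by rewrite derive1E; apply: continuous_cvg; [exact: cL|exact: dX].
  by apply/funext => h /=; rewrite LZ LB.
by apply: DeriveDef; [exact: cvgP cv|exact: cvg_lim cv].
Qed.

Lemma is_derive_mul f g t df dg :
  is_derive t (1 : R) f df -> is_derive t (1 : R) g dg ->
  is_derive t (1 : R) (fun s => f s * g s) (df * g t + f t * dg).
Proof.
move=> f' g'; apply: is_derive_eq (is_deriveM f' g') _.
by rewrite /GRing.scale/= addrC (mulrC df).
Qed.

Lemma is_derive_inv f t df : f t != 0 -> is_derive t (1 : R) f df ->
  is_derive t (1 : R) (fun s => (f s)^-1) (- df / f t ^+ 2).
Proof.
move=> ft0 f'; apply: is_derive_eq (is_deriveV ft0 f') _.
by rewrite /GRing.scale/= mulNr mulrC -mulNr.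
Qed.

Lemma is_derive_dot u v t du dv :
  (forall i, is_derive t (1 : R) (fun s => u s 0 i) (du 0 i)) ->
  (forall i, is_derive t (1 : R) (fun s => v s 0 i) (dv 0 i)) ->
  is_derive t (1 : R) (fun s => dot (u s) (v s)) (dot du (v t) + dot (u t) dv).
Proof.
move=> u' v'.
rewrite (_ : (fun s => _) = (fun s => u s 0 0 * v s 0 0 + u s 0 1 * v s 0 1 +
    u s 0 2 * v s 0 2)); last by apply/funext => s; rewrite dotE.
have H i := is_derive_mul (u' i) (v' i).
apply: is_derive_eq (is_deriveD (is_deriveD (H 0) (H 1)) (H 2)) _.
by rewrite !dotE; ring.
Qed.

Lemma is_derive_cross u v t du dv :
  (forall i, is_derive t (1 : R) (fun s => u s 0 i) (du 0 i)) ->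
  (forall i, is_derive t (1 : R) (fun s => v s 0 i) (dv 0 i)) ->
  forall i, is_derive t (1 : R) (fun s => cross (u s) (v s) 0 i)
    ((cross du (v t) + cross (u t) dv) 0 i).
Proof.
move=> u' v' i.
rewrite (_ : (fun s => _) = (fun s => u s 0 (i + 1) * v s 0 (i + 2) -
    u s 0 (i + 2) * v s 0 (i + 1))); last by apply/funext => s; rewrite mxE.
have H i j := is_derive_mul (u' i) (v' j).
apply: is_derive_eq (is_deriveB (H (i + 1) (i + 2)) (H (i + 2) (i + 1))) _.
by rewrite !mxE; ring.
Qed.

Lemma is_derive_enorm u t du : u t != 0 ->
  (forall i, is_derive t (1 : R) (fun s => u s 0 i) (du 0 i)) ->
  is_derive t (1 : R) (fun s => enorm (u s)) (dot (u t) du / enorm (u t)).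
Proof.
move=> u0 u'; have := is_derive1_sqrt (dot_gt0 u0).
move=> /is_derive1_comp /(_ (is_derive_dot u' u')) /is_derive_eq; apply.
rewrite -/(enorm (u t)) (dotC du); field.
by rewrite gt_eqF// enorm_gt0.
Qed.

Lemma is_derive_cst_coord (c : 'rV[R]_3) t i :
  is_derive t (1 : R) (fun=> c 0 i) ((0 : 'rV[R]_3) 0 i).
Proof. by rewrite mxE; exact: is_derive_cst. Qed.

Lemma abs_continuous_dot a b u v :
  (forall i, abs_continuous a b (fun s => u s 0 i)) ->
  (forall i, abs_continuous a b (fun s => v s 0 i)) ->
  abs_continuous a b (fun s => dot (u s) (v s)).
Proof.
move=> acu acv.
rewrite (_ : (fun s => _) = (fun s => u s 0 0 * v s 0 0 + u s 0 1 * v s 0 1 +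
    u s 0 2 * v s 0 2)); last by apply/funext => s; rewrite dotE.
by do 2?apply: abs_continuousD; exact: abs_continuousM.
Qed.

Lemma abs_continuous_cross a b u v :
  (forall i, abs_continuous a b (fun s => u s 0 i)) ->
  (forall i, abs_continuous a b (fun s => v s 0 i)) ->
  forall i, abs_continuous a b (fun s => cross (u s) (v s) 0 i).
Proof.
move=> acu acv i.
rewrite (_ : (fun s => _) = (fun s => u s 0 (i + 1) * v s 0 (i + 2) +
    - (u s 0 (i + 2) * v s 0 (i + 1)))); last by apply/funext => s; rewrite mxE.
by apply: abs_continuousD; [|apply: abs_continuousN]; exact: abs_continuousM.
Qed.

Lemma abs_continuous_enorm a b u :
  (forall t, a <= t <= b -> u t != 0) ->
  (forall i, abs_continuous a b (fun s => u s 0 i)) ->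
  abs_continuous a b (fun s => enorm (u s)).
Proof.
move=> u0 acu; apply: abs_continuous_sqrt => [|t tab].
  exact: abs_continuous_dot.
exact/dot_gt0/u0.
Qed.

End curves.

(** * Derivatives of the RTN components of a fixed vector *)

Section rtn_frame.
Context {R : realType}.
Implicit Types (y : state R) (A hd : 'rV[R]_3).

Lemma compRE y A : compR y A = dot A y.1 / enorm y.1.
Proof. by rewrite /compR dotZr mulrC. Qed.

Lemma compNE y A : compN y A = dot A (ang_mom y) / enorm (ang_mom y).
Proof. by rewrite /compN dotZr mulrC. Qed.

Lemma compTE y A : compT y A =
  dot A (cross (ang_mom y) y.1) / (enorm (ang_mom y) * enorm y.1).
Proof.
rewrite /compT /thetahat /hhat /rhat; move: (ang_mom y) => h.
by rewrite !dotE !crossE !mxE invfM; ring.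
Qed.

Lemma sNE lam hd y : sN lam hd y = lam * compR y hd + compT y hd.
Proof. by rewrite /sN dotDr dotZr. Qed.

Variables (x : R -> state R) (t : R) (a hd : 'rV[R]_3).
Hypotheses (xt : rtn_defined (x t))
  (r' : forall i, is_derive t (1 : R) (fun s => (x s).1 0 i) ((x t).2 0 i))
  (v' : forall i, is_derive t (1 : R) (fun s => (x s).2 0 i) (a 0 i)).
Let r := enorm (x t).1.
Let h := enorm (ang_mom (x t)).

Let r0 : 0 < r. Proof. by apply: enorm_gt0; case: xt. Qed.
Let h0 : 0 < h. Proof. by apply: enorm_gt0; case: xt. Qed.

Let h' i : is_derive t (1 : R) (fun s => ang_mom (x s) 0 i) (cross (x t).1 a 0 i).
Proof.
apply: is_derive_eq (is_derive_cross r' v' i) _.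
by rewrite crossvv add0r.
Qed.

Let normr' : is_derive t (1 : R) (fun s => enorm (x s).1) (dot (x t).1 (x t).2 / r).
Proof. by apply: is_derive_enorm r'; case: xt. Qed.

Let normh' : is_derive t (1 : R) (fun s => enorm (ang_mom (x s)))
  (dot (ang_mom (x t)) (cross (x t).1 a) / h).
Proof. by apply: is_derive_enorm h'; case: xt. Qed.

Let dot0l A : dot 0 A = 0. Proof. by rewrite dotE !mxE !mul0r !addr0. Qed.

Lemma is_derive_compR : is_derive t (1 : R) (fun s => compR (x s) hd)
  (h / r ^+ 2 * compT (x t) hd).
Proof.
under [fun s => _]funext do rewrite compRE.
have := is_derive_mul (is_derive_dot (is_derive_cst_coord hd t) r')
  (@is_derive_inv _ (fun s => enorm (x s).1) t _ (lt0r_neq0 r0) normr').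
move=> /is_derive_eq; apply.
rewrite compTE -/r -/h dot_cross_cross -sqr_enorm -/r dot0l.
by field; rewrite !gt_eqF.
Qed.

Lemma is_derive_compN : is_derive t (1 : R) (fun s => compN (x s) hd)
  (- (r * compN (x t) a / h * compT (x t) hd)).
Proof.
under [fun s => _]funext do rewrite compNE.
have := is_derive_mul (is_derive_dot (is_derive_cst_coord hd t) h')
  (@is_derive_inv _ (fun s => enorm (ang_mom (x s))) t _ (lt0r_neq0 h0) normh').
move=> /is_derive_eq; apply.
rewrite compTE compNE -/r -/h dot0l.
have := angular_acceleration_transverse hd (x t).1 (x t).2 a.
rewrite -/(ang_mom (x t)) -sqr_enorm -/h => E.
(* Clearing denominators by [h ^+ 4] exposes the left side of [angular_acceleration_transverse]. *)
apply: (@mulIf _ (h ^+ 4)); first by rewrite expf_neq0// gt_eqF.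
transitivity (h * (h ^+ 2 * dot hd (cross (x t).1 a) -
  dot (ang_mom (x t)) (cross (x t).1 a) * dot hd (ang_mom (x t)))).
  by field; rewrite !gt_eqF.
by rewrite E; field; rewrite !gt_eqF.
Qed.

(** Here [thetahat' = (r a_N / h) hhat - (h / r^2) rhat]: the first term comes from the rotation of
    [hhat], the second from that of [rhat]. *)
Lemma is_derive_compT : is_derive t (1 : R) (fun s => compT (x s) hd)
  (r * compN (x t) a / h * compN (x t) hd - h / r ^+ 2 * compR (x t) hd).
Proof.
under [fun s => _]funext do rewrite compTE.
have hr' := is_derive_mul normh' normr'.
have hr0 : h * r != 0 by rewrite mulf_neq0// gt_eqF.
have := is_derive_mul (is_derive_dot (is_derive_cst_coord hd t)
  (is_derive_cross h' r')) 
  (@is_derive_inv _ (fun s => enorm (ang_mom (x s)) * enorm (x s).1) t _ hr0 hr').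
move=> /is_derive_eq; apply.
rewrite !compNE compRE -/r -/h dot0l dotDr.
have := angular_acceleration_normal hd (x t).1 (x t).2 a.
have := transverse_rotation hd (x t).1 (x t).2.
rewrite -/(ang_mom (x t)) -!sqr_enorm -/h -/r => E2 E1.
apply: (@mulIf _ (h ^+ 3 * r ^+ 3)); first by rewrite mulf_neq0// expf_neq0// gt_eqF.
transitivity (r ^+ 2 * (h ^+ 2 * dot hd (cross (cross (x t).1 a) (x t).1)
    - dot (ang_mom (x t)) (cross (x t).1 a) * dot hd (cross (ang_mom (x t)) (x t).1))
  + h ^+ 2 * (r ^+ 2 * dot hd (cross (ang_mom (x t)) (x t).2)
    - dot (x t).1 (x t).2 * dot hd (cross (ang_mom (x t)) (x t).1))).
  by field; rewrite !gt_eqF.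
by rewrite E1 E2; field; rewrite !gt_eqF.
Qed.

End rtn_frame.

(** * Orthonormality of the frame and absolute continuity of the components *)

Section rtn_components.
Context {R : realType}.
Implicit Types (y : state R) (A hd : 'rV[R]_3).

(** Parseval's identity for the orthonormal RTN frame. The transverse square is a squared triple
    product, which the Gram determinant expresses through the other two components since [ang_mom y]
    and [y.1] are orthogonal. *)
Lemma sqr_comp y A : rtn_defined y ->
  compR y A ^+ 2 + compT y A ^+ 2 + compN y A ^+ 2 = dot A A.
Proof.
move=> [/enorm_gt0 r0 /enorm_gt0 h0].
rewrite compRE compTE compNE.
have := sqr_triple A (ang_mom y) y.1.
rewrite (dotC (ang_mom y)) dot_cross_self -!sqr_enorm => E.
rewrite [X in _ + X + _]expr_div_n E; field.
by rewrite !gt_eqF.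
Qed.

(** Coordinates of a state are 1-Lipschitz for the sup norm; sums, products and quotients follow,
    the norms in the denominators being positive throughout [[a, b]]. *)
Lemma abs_continuous_comp (x : R -> state R) hd a b :
  (forall t, a <= t <= b -> rtn_defined (x t)) -> abs_continuous a b x ->
  [/\ abs_continuous a b (fun t => compR (x t) hd),
      abs_continuous a b (fun t => compT (x t) hd),
      abs_continuous a b (fun t => compN (x t) hd),
      abs_continuous a b (fun t => enorm (x t).1) &
      abs_continuous a b (fun t => enorm (ang_mom (x t)))].
Proof.
move=> xdef acx.
have coord_le (z : 'rV[R]_3) i : `|z 0 i| <= `|z|.
  by rewrite /Num.norm/= mx_normrE; apply: (le_bigmax _ (fun ij => `|z ij.1 ij.2|) (0, i)).
have le1 (z : state R) i : `|z.1 0 i| <= `|z|.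
  by apply: (le_trans (coord_le z.1 i)); rewrite prod_normE le_max lexx.
have le2 (z : state R) i : `|z.2 0 i| <= `|z|.
  by apply: (le_trans (coord_le z.2 i)); rewrite prod_normE le_max lexx orbT.
have acr i : abs_continuous a b (fun t => (x t).1 0 i).
  apply: (@abs_continuous_dominated _ _ _ _ _ _ 1 _ _ _ acx acx) => u v _ _ _.
  by rewrite mul1r ler_wpDr//; have := le1 (x v - x u) i; rewrite !mxE.
have acv i : abs_continuous a b (fun t => (x t).2 0 i).
  apply: (@abs_continuous_dominated _ _ _ _ _ _ 1 _ _ _ acx acx) => u v _ _ _.
  by rewrite mul1r ler_wpDr//; have := le2 (x v - x u) i; rewrite !mxE.
have ach := abs_continuous_cross acr acv.
have achd i : abs_continuous a b (fun=> hd 0 i) by exact: abs_continuous_cst.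
have acnr : abs_continuous a b (fun t => enorm (x t).1).
  by apply: abs_continuous_enorm acr => t /xdef[].
have acnh : abs_continuous a b (fun t => enorm (ang_mom (x t))).
  by apply: abs_continuous_enorm ach => t /xdef[].
have r0 t : a <= t <= b -> 0 < enorm (x t).1.
  by move=> /xdef[? _]; exact: enorm_gt0.
have h0 t : a <= t <= b -> 0 < enorm (ang_mom (x t)).
  by move=> /xdef[_ ?]; exact: enorm_gt0.
split=> //.
- have -> : (fun t => compR (x t) hd) = (fun t => dot hd (x t).1 / enorm (x t).1).
    by apply/funext => t; rewrite compRE.
  by apply: abs_continuousM; [exact: (@abs_continuous_dot _ a b (fun=> hd))|exact: abs_continuousV].
- have -> : (fun t => compT (x t) hd) = (fun t =>
    dot hd (cross (ang_mom (x t)) (x t).1) / (enorm (ang_mom (x t)) * enorm (x t).1)).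
    by apply/funext => t; rewrite compTE.
  apply: abs_continuousM; first apply: (@abs_continuous_dot _ a b (fun=> hd)) => //.
    exact: abs_continuous_cross.
  apply: abs_continuousV; first exact: abs_continuousM.
  by move=> t tab; rewrite mulr_gt0 ?r0 ?h0.
- have -> : (fun t => compN (x t) hd) =
    (fun t => dot hd (ang_mom (x t)) / enorm (ang_mom (x t))).
    by apply/funext => t; rewrite compNE.
  by apply: abs_continuousM; [exact: (@abs_continuous_dot _ a b (fun=> hd))|exact: abs_continuousV].
Qed.


End rtn_components.
(** * Filippov velocities *)

Section filippov_values.
Context {R : realType}.
Notation state := (state R).

(** It allows the Filippov hull to be taken with no points removed. *)
Lemma null_set_set0 : Defs.null_set (set0 : set state).
Proof.
(* Cube [k] has edge [m / 2 ^ k.+1 <= 1], so its volume is at most the edge itself, and the edges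
   sum to at most [e]. *)
move=> e e0; pose m := Num.min 1 e.
have m0 : 0 < m by rewrite lt_min ltr01 e0.
have p0 k : 0 < m / (2 ^ k.+1)%:R by rewrite divr_gt0// ltr0n expn_gt0.
exists (fun=> 0), (fun k => m / (2 ^ k.+1)%:R / 2); split.
- by move=> k; rewrite divr_gt0.
- exact: sub0set.
- apply: le_trans (@epsilon_trick0 R e xpredT (ltW e0)).
  apply: lee_nneseries => [k _ _|k _]; rewrite lee_fin.
    by rewrite exprn_ge0// mulr_ge0// divr_ge0// ltW.
  rewrite mulrCA divff// mulr1 (@le_trans _ _ (m / (2 ^ k.+1)%:R))//.
    rewrite -[leRHS]expr1 ler_wiXn2l//; first exact: ltW.
    rewrite ler_pdivrMr ?ltr0n ?expn_gt0// mul1r (@le_trans _ _ 1)//.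
      by rewrite ge_min lexx.
    by rewrite ler1n expn_gt0.
  by rewrite ler_wpM2r ?invr_ge0// ge_min lexx orbT.
Qed.

(** For each [e], the slab [|L z - c| <= e] is closed and convex and contains all values of [F] near
    [y], hence also the Filippov set. [F] itself may be discontinuous: convergence of the single
    linear form [L] suffices. *)
Lemma filippov_cvg (F : state -> R -> state) y t w (L : state -> R) c :
  continuous L -> (forall a y z, L (a *: y + z) = a * L y + L z) ->
  L (F z t) @[z --> y] --> c -> filippov F y t w -> L w = c.
Proof.
move=> cL linL cv Fw.
apply/eqP; rewrite -subr_eq0 -normr_le0; apply/ler_addgt0Pr => e e0; rewrite add0r.
have /nbhs_ballP[d /= d0 Hd] : \forall z \near y, `|L (F z t) - c| <= e.
  move/cvgrPdist_lt : cv => /(_ e e0); apply: filterS => z.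
  by rewrite distrC => /ltW.
have := Fw d d0 set0 null_set_set0 [set z | `|L z - c| <= e].
apply; split.
- apply: (@closed_comp _ _ (fun z => `|L z - c|) [set r : R | r <= e]).
    by move=> z _; apply: cvg_norm; apply: cvgB; [exact: cL|exact: cvg_cst].
  exact: closed_le.
- move=> z1 z2 p; rewrite !inE/= => h1 h2.
  have -> : conv p z1 z2 = p%:num *: (z1 : state) + (1 - p%:num) *: (z2 : state) by [].
  have L0 : L 0 = 0 by have := linL 1 0 0; rewrite scale1r addr0 mul1r; lra.
  have LZ a z : L (a *: z) = a * L z by rewrite -[a *: z]addr0 linL L0 addr0.
  rewrite linL LZ.
  have p0 : 0 <= p%:num by [].
  have p1 : 0 <= (1 - p%:num) by rewrite subr_ge0.
  rewrite (_ : _ - c = p%:num * (L z1 - c) + (1 - p%:num) * (L z2 - c)); last first.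
    by ring.
  rewrite (le_trans (ler_normD _ _))// !normrM (ger0_norm p0) (ger0_norm p1).
  rewrite (_ : e = p%:num * e + (1 - p%:num) * e); last by ring.
  by rewrite lerD// ler_wpM2l.
- by move=> _ [z [yz _] <-]; exact: Hd.
Qed.

End filippov_values.

(** * Continuity of the RTN frame in the state *)

Section continuity.
Context {R : realType}.

Section limits.
Variables (T : Type) (G : set_system T).
Context {FG : Filter G}.
Implicit Types (u v : T -> 'rV[R]_3) (U V : 'rV[R]_3).

Lemma cvg_dot u v U V :
  (forall i, u z 0 i @[z --> G] --> U 0 i) ->
  (forall i, v z 0 i @[z --> G] --> V 0 i) ->
  dot (u z) (v z) @[z --> G] --> dot U V.
Proof.
move=> uU vV; rewrite dotE (_ : (fun z => dot (u z) (v z)) = (fun z =>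
    u z 0 0 * v z 0 0 + u z 0 1 * v z 0 1 + u z 0 2 * v z 0 2)).
  by apply: cvgD; [apply: cvgD|]; exact: cvgM.
by apply/funext => z; rewrite dotE.
Qed.

Lemma cvg_cross u v U V :
  (forall i, u z 0 i @[z --> G] --> U 0 i) ->
  (forall i, v z 0 i @[z --> G] --> V 0 i) ->
  forall i, cross (u z) (v z) 0 i @[z --> G] --> cross U V 0 i.
Proof.
move=> uU vV i; rewrite mxE (_ : (fun z => cross (u z) (v z) 0 i) = (fun z =>
    u z 0 (i + 1) * v z 0 (i + 2) - u z 0 (i + 2) * v z 0 (i + 1))).
  by apply: cvgB; exact: cvgM.
by apply/funext => z; rewrite mxE.
Qed.

Lemma cvg_scale (a : T -> R) u (b : R) U : a z @[z --> G] --> b ->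
  (forall i, u z 0 i @[z --> G] --> U 0 i) ->
  forall i, (a z *: u z) 0 i @[z --> G] --> (b *: U) 0 i.
Proof.
move=> ab uU i; rewrite mxE (_ : (fun z => (a z *: u z) 0 i) = (fun z => a z * u z 0 i)).
  exact: cvgM.
by apply/funext => z; rewrite mxE.
Qed.

Lemma cvg_enorm u U : (forall i, u z 0 i @[z --> G] --> U 0 i) ->
  enorm (u z) @[z --> G] --> enorm U.
Proof.
move=> uU; have uU2 := cvg_dot uU uU.
exact: (cvg_comp _ _ uU2 (@sqrt_continuous R (dot U U))).
Qed.

End limits.

Implicit Types (y : state R) (A hd : 'rV[R]_3).

Lemma cvg_position y (i : 'I_3) : (z : state R).1 0 i @[z --> y] --> y.1 0 i.
Proof.
apply: (cvg_comp fst (fun A : 'rV[R]_3 => A 0 i)).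
  exact: cvg_fst.
exact: coord_continuous.
Qed.

Lemma cvg_velocity y (i : 'I_3) : (z : state R).2 0 i @[z --> y] --> y.2 0 i.
Proof.
apply: (cvg_comp snd (fun A : 'rV[R]_3 => A 0 i)).
  exact: cvg_snd.
exact: coord_continuous.
Qed.

Lemma cvg_ang_mom y i : ang_mom z 0 i @[z --> y] --> ang_mom y 0 i.
Proof. by apply: cvg_cross; [exact: cvg_position|exact: cvg_velocity]. Qed.

Lemma cvg_rhat y : rtn_defined y -> forall i, rhat z 0 i @[z --> y] --> rhat y 0 i.
Proof.
move=> [r0 _]; apply: cvg_scale; last exact: cvg_position.
by apply: cvgV; [rewrite gt_eqF// enorm_gt0|apply: cvg_enorm; exact: cvg_position].
Qed.

Lemma cvg_hhat y : rtn_defined y -> forall i, hhat z 0 i @[z --> y] --> hhat y 0 i.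
Proof.
move=> [_ h0]; apply: cvg_scale; last exact: cvg_ang_mom.
by apply: cvgV; [rewrite gt_eqF// enorm_gt0|apply: cvg_enorm; exact: cvg_ang_mom].
Qed.

Lemma cvg_thetahat y : rtn_defined y ->
  forall i, thetahat z 0 i @[z --> y] --> thetahat y 0 i.
Proof. by move=> ydef; apply: cvg_cross; [exact: cvg_hhat|exact: cvg_rhat]. Qed.

Lemma near_rtn_defined y : rtn_defined y -> \forall z \near y, rtn_defined z.
Proof.
move=> [r0 h0].
have H (u : state R -> 'rV[R]_3) : u y != 0 ->
    (forall i, u z 0 i @[z --> y] --> u y 0 i) -> \forall z \near y, u z != 0.
  move=> uy0 /cvg_enorm/cvgr_gt/(_ _ (enorm_gt0 uy0)).
  apply: filterS => z; apply: contraTneq => ->.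
  by rewrite /enorm dotE !mxE !mul0r !addr0 sqrtr0 ltxx.
near=> z; split; near: z.
  by apply: (H fst) => //; exact: cvg_position.
by apply: H => //; exact: cvg_ang_mom.
Unshelve. all: by end_near. Qed.

End continuity.

(** * The angle between [hhat] and the desired direction *)

Section desired_direction.
Context {R : realType}.
Variable hd : 'rV[R]_3.
Hypothesis hd1 : enorm hd = 1.
Implicit Types y : state R.

Let dot_hd : dot hd hd = 1.
Proof. by rewrite -sqr_enorm hd1 expr1n. Qed.

Lemma compN_itv y : rtn_defined y -> -1 <= compN y hd <= 1.
Proof.
move=> ydef; have := sqr_comp hd ydef; rewrite dot_hd => E.
rewrite -ler_norml -(@ler_pXn2r _ 2)// ?nnegrE// expr1n real_normK ?num_real//.
have := sqr_ge0 (compR y hd); have := sqr_ge0 (compT y hd); lra.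
Qed.

Lemma beta_lt_pihalf y : rtn_defined y -> (beta hd y < pi / 2) = (0 < compN y hd).
Proof.
move=> /compN_itv pI; rewrite /beta dotC -/(compN y hd).
have [/andP[a0 api] ap] := acos_def pI.
have pi0 := pi_gt0 R.
rewrite -[in RHS]ap -(@cos_pihalf R) ltr_cos//; rewrite in_itv/=; lra.
Qed.

Lemma beta_lt y z : rtn_defined y -> rtn_defined z ->
  (beta hd z < beta hd y) = (compN y hd < compN z hd).
Proof.
move=> /compN_itv yI /compN_itv zI.
rewrite /beta (dotC _ hd) (dotC _ hd) -/(compN y hd) -/(compN z hd).
have [aI ay] := acos_def yI; have [bI bz] := acos_def zI.
by rewrite -[in RHS]ay -[in RHS]bz ltr_cos.
Qed.

(** Two unit vectors with cosine [p] have squared distance [2 * (1 - p)], and [p ^+ 2 <= p] for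
    [0 <= p <= 1]. The bound is put in terms of [1 - p ^+ 2], the quantity whose decay is tracked on
    the surface. *)
Lemma sqr_hhatB_le y i : rtn_defined y -> 0 <= compN y hd ->
  (hhat y 0 i - hd 0 i) ^+ 2 <= 2 * (1 - compN y hd ^+ 2).
Proof.
move=> ydef p0; have /andP[_ p1] := compN_itv ydef.
have h0 : 0 < enorm (ang_mom y) by case: ydef => _; exact: enorm_gt0.
have hh1 : dot (hhat y) (hhat y) = 1.
  by rewrite dotZl dotZr -sqr_enorm; field; rewrite gt_eqF.
have := sqr_coord_le (hhat y - hd) i; rewrite !mxE => /le_trans; apply.
rewrite dotBr (dotC _ (hhat y)) (dotC _ hd) !dotBr (dotC (hhat y) hd) dot_hd hh1.
rewrite -/(compN y hd).
have : compN y hd ^+ 2 <= compN y hd by rewrite expr2 ler_piMr.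
lra.
Qed.

Lemma hhat_eq y : rtn_defined y -> 0 <= compN y hd ->
  compN y hd ^+ 2 = 1 -> hhat y = hd.
Proof.
move=> ydef p0 p1; apply/rowP => i; apply/eqP.
rewrite -subr_eq0 -sqrf_eq0 eq_le sqr_ge0 andbT.
by have := sqr_hhatB_le i ydef p0; rewrite p1 subrr mulr0.
Qed.

End desired_direction.

(** * Normal acceleration of the closed loop off the sliding surface *)

Section closed_loop_acceleration.
Context {R : realType}.
Variables (f d u : state R -> R -> 'rV[R]_3) (hd : 'rV[R]_3).
Variables (lambdaN KN : R) (y : state R) (t : R) (w : state R).
Hypothesis hd1 : enorm hd = 1.
Hypothesis ydef : rtn_defined y.
Hypothesis Fw : filippov (closed_loop f d u) y t w.

Lemma filippov_position : w.1 = y.2.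
Proof.
apply/rowP => i.
apply: (filippov_cvg (L := fun z : state R => z.1 0 i) _ _ _ Fw).
- by move=> z; exact: cvg_position.
- by move=> a z1 z2; rewrite !mxE.
- exact: cvg_velocity.
Qed.

Hypothesis fc : {for (y, t), continuous (fun p : state R * R => f p.1 p.2)}.
Hypothesis dc : {for y, continuous (d ^~ t)}.
Hypothesis ub : bounded_near (u ^~ t) (nbhs y).
Hypothesis law : forall z, rtn_defined z -> beta hd z < pi / 2 ->
  compN z (u z t) = normal_law lambdaN KN hd f z t.
Hypothesis ybeta : beta hd y < pi / 2.
Hypothesis sy0 : sN lambdaN hd y != 0.

Let p0 : 0 < compN y hd. Proof. by rewrite -beta_lt_pihalf. Qed.

Let cvg_f i : f z t 0 i @[z --> y] --> f y t 0 i.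
Proof.
have h1 : (z, t) @[z --> y] --> (y, t) 
    by apply: (@cvg_pair _ _ _ (nbhs y) (nbhs y) (nbhs t) _ _ _ id (fun=> t));
      [exact: cvg_id|exact: cvg_cst].
have h2 := cvg_comp _ _ h1 fc.
exact: (cvg_comp _ (fun A : 'rV[R]_3 => A 0 i) h2 (@coord_continuous _ _ _ _ _ _)).
Qed.

Let cvg_d i : d z t 0 i @[z --> y] --> d y t 0 i.
Proof.
exact: (cvg_comp _ (fun A : 'rV[R]_3 => A 0 i) dc (@coord_continuous _ _ _ _ _ _)).
Qed.

Let cvg_cstv (A : 'rV[R]_3) i : A 0 i @[z --> y] --> A 0 i.
Proof. exact: cvg_cst. Qed.

Let cvg_compN : compN z hd @[z --> y] --> compN y hd.
Proof. by apply: (@cvg_dot _ _ _ _ (fun=> hd)); [exact: cvg_cstv|exact: cvg_hhat]. Qed.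

Let cvg_sN : sN lambdaN hd z @[z --> y] --> sN lambdaN hd y.
Proof.
rewrite sNE (_ : (fun z => sN _ _ z) =
    (fun z => lambdaN * compR z hd + compT z hd)); last first.
  by apply/funext => z; rewrite sNE.
apply: cvgD; last by apply: (@cvg_dot _ _ _ _ (fun=> hd)); [exact: cvg_cstv|exact: cvg_thetahat].
apply: cvgM; first exact: cvg_cst.
by apply: (@cvg_dot _ _ _ _ (fun=> hd)); [exact: cvg_cstv|exact: cvg_rhat].
Qed.

Let cvg_sg : Num.sg (sN lambdaN hd z) @[z --> y] --> Num.sg (sN lambdaN hd y).
Proof.
apply: cvg_near_cst; move: sy0; rewrite neq_lt => /orP[s0|s0].
  have /cvgr_lt/(_ _ s0) := cvg_sN; apply: filterS => z sz.
  by apply/eqP; rewrite !ltr0_sg.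
have /cvgr_gt/(_ _ s0) := cvg_sN; apply: filterS => z sz.
by apply/eqP; rewrite !gtr0_sg.
Qed.

Let cvg_law : normal_law lambdaN KN hd f z t @[z --> y] -->
  normal_law lambdaN KN hd f y t.
Proof.
have [r0 h0] := ydef.
have cr : enorm z.1 @[z --> y] --> enorm y.1 by apply: cvg_enorm; exact: cvg_position.
have ch : enorm (ang_mom z) @[z --> y] --> enorm (ang_mom y).
  by apply: cvg_enorm; exact: cvg_ang_mom.
apply: cvgB; last by apply: cvg_dot => //; exact: cvg_hhat.
apply: cvgB; last by apply: cvgM => //; exact: cvg_cst.
apply: cvgM.
  apply: cvgM; first by rewrite /GRing.exp/=; exact: cvgM.
  apply: cvgV; first by rewrite mulf_neq0 ?expf_neq0// gt_eqF// enorm_gt0.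
  by apply: cvgM => //; rewrite /GRing.exp/=; apply: cvgM => //; exact: cvgM.
apply: cvgB; first by apply: (@cvg_dot _ _ _ _ (fun=> hd)); [exact: cvg_cstv|exact: cvg_rhat].
apply: cvgM; first exact: cvg_cst.
by apply: (@cvg_dot _ _ _ _ (fun=> hd)); [exact: cvg_cstv|exact: cvg_thetahat].
Qed.

(* The law fixes the component of u along [hhat z], whereas the velocities at y
   are measured along [hhat y]. *)
Let cvg_frame_mismatch : dot (u z t) (hhat y - hhat z) @[z --> y] --> 0.
Proof.
have [M [_ HM]] := ub.
have uM : \forall z \near y, `|u z t| <= M + 1 by apply: HM; rewrite ltrDl.
pose G z := (M + 1) * (`|hhat y 0 0 - hhat z 0 0| + `|hhat y 0 1 - hhat z 0 1|
  + `|hhat y 0 2 - hhat z 0 2|).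
have G0 : G z @[z --> y] --> 0.
  rewrite -[X in _ --> X](mulr0 (M + 1)).
  apply: cvgM; first exact: cvg_cst.
  have H i : `|hhat y 0 i - hhat z 0 i| @[z --> y] --> 0.
    rewrite -[X in _ --> X](normr0 R) -[X in `|X|](subrr (hhat y 0 i)).
    by apply: cvg_norm; apply: cvgB; [exact: cvg_cst|exact: cvg_hhat].
  rewrite -[X in _ --> X](addr0 0) -[X in _ --> X + _](addr0 0).
  by do 2?apply: cvgD.
have NG0 : - G z @[z --> y] --> 0 by rewrite -[X in _ --> X]oppr0; exact: cvgN.
apply: squeeze_cvgr NG0 G0.
apply: filterS uM => z uM; rewrite -ler_norml /G dotE !mxE.
have coord_le i : `|u z t 0 i| <= M + 1.
  apply: le_trans uM; rewrite /Num.norm/= mx_normrE.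
  exact: (le_bigmax _ (fun ij => `|u z t ij.1 ij.2|) (0, i)).
have step i (b : R) : `|u z t 0 i * b| <= (M + 1) * `|b|.
  by rewrite normrM ler_wpM2r.
rewrite (le_trans (ler_normD _ _))// [leRHS]mulrDr lerD//.
by rewrite (le_trans (ler_normD _ _))// [leRHS]mulrDr lerD.
Qed.

(** Along the fixed direction [hhat y] the control contributes the law at [z] plus the frame
    mismatch, so the normal component of the closed loop has a limit at [y] although [u] itself may
    have none; [filippov_cvg] then leaves a single value. *)
Lemma filippov_normal_acceleration : compN y w.2 =
  normal_law lambdaN KN hd f y t + compN y (f y t) + compN y (d y t).
Proof.
apply: (filippov_cvg (L := fun z : state R => compN y z.2) _ _ _ Fw).
- move=> z; apply: (@cvg_dot _ _ _ _ snd (fun=> hhat y)) => i; last exact: cvg_cst.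
  exact: cvg_velocity.
- by move=> a z1 z2; rewrite /compN dotDl dotZl.
have cN : dot (f z t) (hhat y) + dot (d z t) (hhat y)
    + (normal_law lambdaN KN hd f z t + dot (u z t) (hhat y - hhat z)) @[z --> y] -->
    compN y (f y t) + compN y (d y t) + (normal_law lambdaN KN hd f y t + 0).
  have chh i : hhat y 0 i @[z --> y] --> hhat y 0 i by exact: cvg_cst.
  apply: cvgD; first apply: cvgD.
  - exact: (cvg_dot cvg_f chh).
  - exact: (cvg_dot cvg_d chh).
  - exact: cvgD.
rewrite (_ : _ + compN y (d y t) = compN y (f y t) + compN y (d y t)
  + (normal_law lambdaN KN hd f y t + 0)); last by ring.
apply: cvg_trans cN; apply: near_eq_cvg.
have /cvgr_gt/(_ _ p0) := cvg_compN; have := near_rtn_defined ydef.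
apply: filterS2 => z zdef pz.
rewrite -law ?beta_lt_pihalf// /compN /closed_loop/= !dotDl dotBr; ring.
Qed.

End closed_loop_acceleration.

(** * Strict decrease of absolutely continuous functions *)

Section strict_decrease.
Context {R : realType}.

(** A nondegenerate interval has positive measure, so no null set contains it. *)
Lemma ae_itv_ex (a b : R) (P : R -> Prop) : a < b ->
  {ae lebesgue_measure, forall t, P t} -> exists2 t, a < t < b & P t.
Proof.
move=> ab [A [mA A0 PA]]; apply: contrapT => noP.
have abA : `]a, b[%classic `<=` A.
  move=> t; rewrite /= in_itv/= => tab; apply: PA => /= Pt.
  by apply: noP; exists t.
have : ((b - a)%:E <= 0 :> \bar R)%E.
  rewrite -A0 (_ : (b - a)%:E = lebesgue_measure `]a, b[%classic).
    by apply: le_measure => //; rewrite inE//; exact: measurable_itv.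
  by rewrite lebesgue_measure_itv/= lte_fin ab EFinB.
by rewrite lee_fin; lra.
Qed.

Lemma is_derive_locally_cst (F : R -> R) (a b t c dF : R) : a < t < b ->
  (forall v, a < v < b -> F v = c) -> is_derive t 1 F dF -> dF = 0.
Proof.
move=> tab Fc F'.
have [_ <-] := F'; rewrite -(@derive_cst _ _ _ c t 1).
apply: near_eq_derive.
have /near_in_itvoo : t \in `]a, b[ by rewrite in_itv.
by apply: filterS => v; rewrite in_itv => /Fc.
Qed.

(** If [F b = F a], monotonicity makes [F] constant, and at some interior point its derivative is
    both zero and negative. Strict negativity is asked only at the level [F a], which suits
    functions that may later reach an equilibrium. *)
Lemma abs_continuous_ae_decreasing (a b : R) (F : R -> R) : a < b ->
  abs_continuous a b F ->
  {ae lebesgue_measure, forall t : R, a < t < b ->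
     exists dF, [/\ is_derive t 1 F dF, dF <= 0 & F t = F a -> dF < 0]} ->
  F b < F a.
Proof.
move=> ab acF dF.
have nincr u v : a <= u -> u <= v -> v <= b -> F v <= F u.
  move=> au uv vb; apply: abs_continuous_ae_nonincreasing => //.
    exact: abs_continuous_sub acF.
  apply: (@filterS _ _ (ae_filter_ringOfSetsType lebesgue_measure) _ _ _ dF).
  move=> t H tuv; have [|l [Fl l0 _]] := H; first by lra.
  by split; [have [] := Fl|rewrite derive1E derive_val].
rewrite lt_neqAle nincr// ?ltW// andbT; apply/negP => /eqP Fab.
have cst v : a < v < b -> F v = F a.
  move=> /andP[/ltW av /ltW vb]; apply/eqP; rewrite eq_le.
  by apply/andP; split; [|rewrite -Fab]; exact: nincr.
have [t tab] := ae_itv_ex ab dF.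
move=> /(_ tab)[l [Fl _ /(_ (cst _ tab))]].
by rewrite (is_derive_locally_cst tab cst Fl) ltxx.
Qed.

End strict_decrease.

(** * Reaching the surface and aligning the orbital plane *)

Theorem theorem1 (R : realType)
  (f d u : state R -> R -> 'rV[R]_3)
  (hd : 'rV[R]_3) (DN lambdaN KN t0 : R) (x : R -> state R)
  (hf : smooth_on [set p : state R * R | rtn_defined p.1]
          (fun p : state R * R => f p.1 p.2))
  (hdist : forall y t, rtn_defined y -> {for y, continuous (d ^~ t)})
  (hu : forall y t, rtn_defined y -> beta hd y < pi / 2 ->
          bounded_near (u ^~ t) (nbhs y))
  (hhd : enorm hd = 1)
  (hlambda : 0 < lambdaN)
  (hK : DN <= KN)
  (hlaw : forall y t, rtn_defined y -> beta hd y < pi / 2 ->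
            compN y (u y t) = normal_law lambdaN KN hd f y t)
  (hsol : filippov_solution (closed_loop f d u) t0 x)
  (hnd : forall t, t0 <= t -> rtn_defined (x t))
  (hbeta : forall t, t0 <= t -> beta hd (x t) < pi / 2)
  (hDN : forall t, t0 <= t -> `|compN (x t) (d (x t) t)| < DN) :
  let s t := sN lambdaN hd (x t) in
  let r t := enorm (x t).1 in
  let h t := enorm (ang_mom (x t)) in
  (* the surface is attractive and invariant *)
  [/\ forall t1 t2, t0 <= t1 -> t1 < t2 -> s t1 != 0 -> `|s t2| < `|s t1|,
      forall t1 t2, t0 <= t1 -> t1 < t2 -> s t1 = 0 -> s t2 = 0,
  (* it is reached unless the reaching rate is integrable *)
      (\int[lebesgue_measure]_(t in `[t0, +oo[)
         (r t / h t * compN (x t) hd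
            * (KN - `|compN (x t) (d (x t) t)|))%:E = +oo)%E ->
      s t @[t --> +oo] --> 0 /\
      exists2 T, t0 <= T & forall t, T <= t -> s t = 0
  (* once reached: the angle decreases, and it vanishes in the limit if the
     angle swept in the orbital plane is infinite *)
    & forall T, t0 <= T -> (forall t, T <= t -> s t = 0) ->
      (forall t1 t2, T <= t1 -> t1 < t2 -> hhat (x t1) <> hd ->
         beta hd (x t2) < beta hd (x t1)) /\
      ((\int[lebesgue_measure]_(t in `[t0, +oo[) (h t / r t ^+ 2)%:E = +oo)%E ->
       hhat (x t) @[t --> +oo] --> hd)].
Proof.
move=> s r h.
pose p t := compN (x t) hd.
pose dN t := compN (x t) (d (x t) t).
have r0 t : t0 <= t -> 0 < r t by move=> /hnd[? _]; exact: enorm_gt0.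
have h0 t : t0 <= t -> 0 < h t by move=> /hnd[_ ?]; exact: enorm_gt0.
have p0 t : t0 <= t -> 0 < p t.
  by move=> tt; rewrite /p -(beta_lt_pihalf hhd (hnd _ tt)); exact: hbeta.
have unit_comp t : t0 <= t ->
    compR (x t) hd ^+ 2 + compT (x t) hd ^+ 2 + p t ^+ 2 = 1.
  by move=> tt; have := sqr_comp hd (hnd _ tt); rewrite -sqr_enorm hhd expr1n.
have [acx aex] := hsol.
have ac a b : t0 <= a -> a <= b -> [/\ abs_continuous a b s,
    abs_continuous a b p, abs_continuous a b r & abs_continuous a b h].
  move=> ta ab; have acx' : abs_continuous a b x.
    by apply: abs_continuous_sub (acx b _) => //; apply: le_trans ab.
  have xdef t : a <= t <= b -> rtn_defined (x t).
    by move=> /andP[at_ _]; apply: hnd; exact: le_trans at_.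
  have [acR acT acN acr ach] := abs_continuous_comp hd xdef acx'.
  split=> //.
  rewrite (_ : s = (fun t => lambdaN * compR (x t) hd + compT (x t) hd)).
    by apply: abs_continuousD => //; apply: abs_continuousM => //; exact: abs_continuous_cst.
  by apply/funext => t; rewrite /s sNE.
(* [aN] is the normal acceleration that the solution actually has. On the surface the hull leaves it
   undetermined, so its value is given only where [s t != 0]. *)
have motion : {ae lebesgue_measure, forall t, t0 < t -> exists aN : R,
    [/\ is_derive t (1 : R) s (lambdaN * (h t / r t ^+ 2 * compT (x t) hd) +
          (r t * aN / h t * p t - h t / r t ^+ 2 * compR (x t) hd)),
        is_derive t (1 : R) p (- (r t * aN / h t * compT (x t) hd)) &
        s t != 0 -> aN = h t ^+ 2 / (r t ^+ 3 * p t) *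
          (compR (x t) hd - lambdaN * compT (x t) hd) - KN * Num.sg (s t) + dN t]}.
  apply: (@filterS _ _ (ae_filter_ringOfSetsType lebesgue_measure) _ _ _ aex).
  move=> t H tt; have [dx Fx] := H tt.
  have t0t := ltW tt; have xdef := hnd _ t0t.
  have xpos := filippov_position Fx.
  have r' i : is_derive t (1 : R) (fun s => (x s).1 0 i) ((x t).2 0 i).
    rewrite -xpos; apply: (@is_derive_continuous_linear _ _ (fun z : state R => z.1 0 i)) => //.
    - by move=> z; exact: cvg_position.
    - by move=> y z; rewrite !mxE.
    - by move=> c y; rewrite !mxE.
  have v' i : is_derive t (1 : R) (fun s => (x s).2 0 i) ((derive1 x t).2 0 i).
    apply: (@is_derive_continuous_linear _ _ (fun z : state R => z.2 0 i)) => //.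
    - by move=> z; exact: cvg_velocity.
    - by move=> y z; rewrite !mxE.
    - by move=> c y; rewrite !mxE.
  exists (compN (x t) (derive1 x t).2); split.
  - have sE : s = (fun t => lambdaN * compR (x t) hd + compT (x t) hd).
      by apply/funext => t'; rewrite /s sNE.
    rewrite sE; apply: is_derive_eq (is_deriveD (is_derive_mul (is_derive_cst lambdaN t 1)
      (is_derive_compR hd xdef r')) (is_derive_compT hd xdef r' v')) _.
    by rewrite mul0r add0r.
  - exact: is_derive_compN.
  - move=> st0; rewrite (@filippov_normal_acceleration R f d u hd lambdaN KN _ _ _ hhd xdef Fx
      _ _ _ _ _ st0).
    + by rewrite /normal_law /p /dN /s /r /h; ring.
    + exact: (hf 0%N).
    + exact: hdist.
    + by apply: hu => //; exact: hbeta.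
    + by move=> z; exact: hlaw.
    + exact: hbeta.
(* After substitution of [aN], the first term of the law cancels the drift of [s] caused by the
   rotation within the orbital plane. *)
have reaching : {ae lebesgue_measure, forall t, t0 < t -> exists ds : R,
    is_derive t (1 : R) s ds /\
    (s t != 0 -> ds = r t / h t * p t * (dN t - KN * Num.sg (s t)))}.
  apply: (@filterS _ _ (ae_filter_ringOfSetsType lebesgue_measure) _ _ _ motion).
  move=> t H tt; have [aN [s' _ aNE]] := H tt.
  have := r0 _ (ltW tt); have := h0 _ (ltW tt); have := p0 _ (ltW tt).
  move=> pt0 ht0 rt0; eexists; split; first exact: s'.
  by move=> /aNE ->; field; rewrite !gt_eqF.
have dNK t : t0 <= t -> `|dN t| < KN by move=> /hDN /lt_le_trans; apply.
have aefilter := ae_filter_ringOfSetsType (@lebesgue_measure R).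
have ssE a b : t0 <= a -> a < b -> {ae lebesgue_measure, forall t : R, a < t < b ->
     exists dF, [/\ is_derive t (1 : R) (fun t => s t * s t) dF, dF <= 0 &
       s t != 0 -> dF < 0]}.
  move=> ta ab; apply: (@filterS _ _ aefilter _ _ _ reaching) => t H /andP[at_ tb].
  have tt : t0 < t by exact: le_lt_trans at_.
  have [ds [s' dsE]] := H tt.
  have neg : s t != 0 -> s t * ds < 0.
    move=> st0; rewrite (dsE st0).
    (* The last factor [dN * s - KN * |s|] is negative because [|dN| < KN]. *)
    rewrite (_ : _ * _ = r t / h t * p t * (dN t * s t - KN * `|s t|)); last first.
      by rewrite normrEsg; ring.
    rewrite pmulr_rlt0; last by rewrite !mulr_gt0 ?invr_gt0 ?r0 ?h0 ?p0// ltW.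
    rewrite subr_lt0 (le_lt_trans (ler_norm _))// normrM ltr_pM2r ?normr_gt0//.
    by apply: dNK; exact: ltW.
  exists (ds * s t + s t * ds); split; first exact: is_derive_mul.
    have [->|/neg] := eqVneq (s t) 0; first by rewrite mulr0 mul0r addr0.
    by rewrite (mulrC ds); lra.
  by move=> /neg; rewrite (mulrC ds); lra.
have acss a b : t0 <= a -> a <= b -> abs_continuous a b (fun t => s t * s t).
  by move=> ta ab; have [acs _ _ _] := ac _ _ ta ab; exact: abs_continuousM.
have attract t1 t2 : t0 <= t1 -> t1 < t2 -> s t1 != 0 -> `|s t2| < `|s t1|.
  move=> tt1 t12 st1; rewrite -(@ltr_pXn2r _ 2)// ?nnegrE// !real_normK ?num_real//.
  rewrite !expr2; apply: (@abs_continuous_ae_decreasing _ t1 t2 (fun t => s t * s t)) => //.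
    by apply: acss => //; exact: ltW.
  (* Where [s ^ 2] still has its value at [t1], [s] is nonzero, which is all that the strict
     decrease asks for. *)
  apply: (@filterS _ _ aefilter _ _ _ (ssE _ _ tt1 t12)) => t H /H[dF [F' F0 Fn]].
  exists dF; split=> // E; apply: Fn; apply: contra_neq st1 => st0.
  by apply/eqP; rewrite -sqrf_eq0 expr2 -E st0 mulr0.
have invariant t1 t2 : t0 <= t1 -> t1 < t2 -> s t1 = 0 -> s t2 = 0.
  move=> tt1 t12 st1.
  have : s t2 * s t2 <= s t1 * s t1.
    apply: (@abs_continuous_ae_nonincreasing _ t1 t2 (fun t => s t * s t)); [exact: ltW| |].
      by apply: acss => //; exact: ltW.
    apply: (@filterS _ _ aefilter _ _ _ (ssE _ _ tt1 t12)) => t H /H[dF [F' F0 _]].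
    by split; [have [] := F'|rewrite derive1E derive_val].
  rewrite st1 mulr0 -expr2 => s2; apply/eqP; rewrite -sqrf_eq0.
  by rewrite eq_le s2 sqr_ge0.
(* On the surface the transverse component is [- lambdaN] times the radial one, and the squares of
   the components of [hd] sum to 1. *)
have sq t : t0 <= t -> s t = 0 ->
    compR (x t) hd ^+ 2 * (1 + lambdaN ^+ 2) = 1 - p t ^+ 2.
  move=> tt; rewrite /s sNE => st0.
  have hT : compT (x t) hd = - (lambdaN * compR (x t) hd) by lra.
  by have := unit_comp _ tt; rewrite hT; lra.
split=> //.
- move=> ioo.
  suff [T tT sT] : exists2 T, t0 <= T & s T = 0.
    have sT0 t : T <= t -> s t = 0.
      by rewrite le_eqVlt => /predU1P[<-//|Tt]; exact: invariant Tt sT.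
    split; last by exists T.
    by apply: cvg_near_cst; apply: filterS (nbhs_pinfty_ge (num_real T)) => t /sT0.
  (* Without a zero, [s] keeps its sign by the intermediate value theorem and [|s|] decreases at
     least at the reaching rate, whose integral would then be bounded by [|s t0|]. *)
  apply: contrapT => noT.
  have s0 t : t0 <= t -> s t != 0.
    by move=> tt; apply/eqP => st; apply: noT; exists t.
  have sgs t : t0 <= t -> Num.sg (s t) = Num.sg (s t0).
    rewrite le_eqVlt => /predU1P[<-//|tt]; have tt' := ltW tt.
    have [acs _ _ _] := ac _ _ (lexx t0) tt'.
    have cs := abs_continuous_within acs.
    have noroot : ~ (Num.min (s t0) (s t) <= 0 <= Num.max (s t0) (s t)).
      move=> /(IVT tt' cs)[c]; rewrite in_itv/= => /andP[tc _] sc.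
      by have := s0 _ tc; rewrite sc eqxx.
    have := s0 _ (lexx t0); have := s0 _ tt'.
    rewrite !neq_lt => /orP[st|st] /orP[st0|st0].
    + by rewrite !ltr0_sg.
    + by case: noroot; rewrite ge_min le_max (ltW st) (ltW st0) orbT.
    + by case: noroot; rewrite ge_min le_max (ltW st) (ltW st0) orbT.
    + by rewrite !gtr0_sg.
  pose g t := r t / h t * p t * (KN - `|dN t|).
  suff : (\int[lebesgue_measure]_(t in `[t0, +oo[) (g t)%:E < +oo)%E by rewrite ioo.
  (* With threshold [t0] the initial interval is the single point [t0], where [g t0] is a bound. *)
  apply: (@integral_itvcy_lt_pinfty _ g (fun t => Num.sg (s t0) * s t) t0 t0 (g t0) 1) => //.
  + move=> t tt; rewrite /g mulr_ge0//; last by rewrite subr_ge0 ltW// dNK.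
    by rewrite ltW// !mulr_gt0 ?invr_gt0 ?r0 ?h0 ?p0.
  + by move=> t tt; rewrite (_ : t = t0)//; lra.
  + by move=> t /sgs <-; rewrite -normrEsg.
  + move=> b tb; have [acs _ _ _] := ac _ _ (lexx t0) tb.
    by apply: abs_continuousM => //; exact: abs_continuous_cst.
  apply: (@filterS _ _ aefilter _ _ _ reaching) => t H tt.
  have [ds [s' dsE]] := H tt; have tt' := ltW tt.
  have Fs' := is_derive_mul (is_derive_cst (Num.sg (s t0)) t 1) s'.
  split; first by have [] := Fs'.
  rewrite derive1E derive_val /= mul0r add0r dsE ?s0// sgs// mul1r.
  have sg1 : Num.sg (s t0) * Num.sg (s t0) = 1.
    by rewrite -expr2 sqr_sg s0.
  rewrite [leLHS](_ : _ = r t / h t * p t * (dN t * Num.sg (s t0)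
    - KN * (Num.sg (s t0) * Num.sg (s t0)))); last by ring.
  rewrite sg1 mulr1 /g -mulrN ler_pM2l ?opprB; last first.
    by rewrite !mulr_gt0 ?invr_gt0 ?r0 ?h0 ?p0.
  rewrite lerD2r (le_trans (ler_norm _))// normrM normr_sg s0// mulr1.
  exact: lexx.
- move=> T tT sT.
  pose q t := 1 - p t ^+ 2.
  have q0 t : t0 <= t -> 0 <= q t.
    move=> /hnd/(compN_itv hhd)/andP[p1 p2]; rewrite /q subr_ge0 -/(p t).
    by rewrite -real_normK ?num_real// expr_le1// ler_norml p1.
  have q' : {ae lebesgue_measure, forall t, T < t ->
      is_derive t (1 : R) q (- (2 * lambdaN * (h t / r t ^+ 2) * q t))}.
    apply: (@filterS _ _ aefilter _ _ _ motion) => t H Tt.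
    have tt : t0 <= t by apply: le_trans tT _; exact: ltW.
    have [aN [s' p' _]] := H (le_lt_trans tT Tt).
    have st0 := sT _ (ltW Tt).
    (* [s] vanishes around [t], hence so does its derivative. This equation replaces the law in
       determining [aN] on the surface. *)
    have ds0 : lambdaN * (h t / r t ^+ 2 * compT (x t) hd) +
        (r t * aN / h t * p t - h t / r t ^+ 2 * compR (x t) hd) = 0.
      apply: (@is_derive_locally_cst _ s T (t + 1) t 0) => //.
        by rewrite Tt ltrDl ltr01.
      by move=> v /andP[Tv _]; apply: sT; exact: ltW.
    have hT : compT (x t) hd = - (lambdaN * compR (x t) hd).
      by move: st0; rewrite /s sNE; lra.
    apply: is_derive_eq (is_deriveB (is_derive_cst (1 : R) t 1) (is_derive_mul p' p')) _.
    rewrite /q -(sq _ tt st0) sub0r; move: ds0; rewrite hT.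
    set A := r t * aN / h t; set c := h t / r t ^+ 2; set hR := compR _ _ => ds0.
    have Ap : A * p t = c * hR * (1 + lambdaN ^+ 2) by lra.
    (* On the surface [p' = lambdaN * hR * A], so [q' = - 2 p p'] contains the product [A * p] that
       the sliding condition supplies. *)
    rewrite [LHS](_ : _ = - (2 * lambdaN * hR * (A * p t))); last by ring.
    by rewrite Ap; ring.
  have acq a b : t0 <= a -> a <= b -> abs_continuous a b q.
    move=> ta ab; have [_ acp _ _] := ac _ _ ta ab.
    apply: abs_continuousD; first exact: abs_continuous_cst.
    by apply: abs_continuousN; exact: abs_continuousM.
  have rate_gt0 t : t0 <= t -> 0 < 2 * lambdaN * (h t / r t ^+ 2).
    by move=> tt; rewrite !mulr_gt0 ?invr_gt0 ?exprn_gt0 ?h0 ?r0.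
  have nq t1 t2 : T <= t1 -> t1 <= t2 -> q t2 <= q t1.
    move=> Tt1 t12; have tt1 := le_trans tT Tt1.
    apply: abs_continuous_ae_nonincreasing => //; first exact: acq.
    apply: (@filterS _ _ aefilter _ _ _ q') => t H /andP[t1t _].
    have Tt := le_lt_trans Tt1 t1t; have tt := le_trans tT (ltW Tt).
    have qt := H Tt; split; first by have [] := qt.
    by rewrite derive1E derive_val oppr_le0 mulr_ge0 ?q0// ltW// rate_gt0.
  split.
    move=> t1 t2 Tt1 t12 hn; have tt1 := le_trans tT Tt1.
    have tt2 := le_trans tt1 (ltW t12).
    have q1 : 0 < q t1.
      rewrite lt_neqAle q0// andbT; apply/negP => /eqP q10; apply: hn.
      apply: (hhat_eq hhd (hnd _ tt1)); first exact/ltW/p0.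
      by rewrite -/(p t1); move: q10; rewrite /q; lra.
    have q12 : q t2 < q t1.
      apply: abs_continuous_ae_decreasing => //; first exact/acq/ltW.
      apply: (@filterS _ _ aefilter _ _ _ q') => t H /andP[t1t _].
      have Tt := le_lt_trans Tt1 t1t; have tt := le_trans tT (ltW Tt).
      exists (- (2 * lambdaN * (h t / r t ^+ 2) * q t)); split; first exact: H.
        by rewrite oppr_le0 mulr_ge0 ?q0// ltW// rate_gt0.
      by move=> ->; rewrite oppr_lt0 mulr_gt0// rate_gt0.
    rewrite (beta_lt hhd (hnd _ tt1) (hnd _ tt2)) -/(p t1) -/(p t2).
    have := ltW (p0 _ tt1); have := ltW (p0 _ tt2) => p2 p1.
    by rewrite -(@ltr_pXn2r _ 2)// ?nnegrE//; move: q12; rewrite /q; lra.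
  move=> ioo.
  (* If [q] stayed above [e], it would decrease at least at the rate [2 * lambdaN * e] times the
     angular speed [h / r ^ 2]; as [q >= 0], the swept angle would be finite. Up to [T] that speed
     is bounded by compactness. *)
  have qsmall e : 0 < e -> exists2 t1, T <= t1 & q t1 <= e.
    move=> e0; apply: contrapT => nq1.
    have qe t : T <= t -> e < q t.
      by move=> Tt; rewrite ltNge; apply/negP => qt; apply: nq1; exists t.
    suff : (\int[lebesgue_measure]_(t in `[t0, +oo[) (h t / r t ^+ 2)%:E < +oo)%E.
      by rewrite ioo.
    have [_ _ acr ach] := ac _ _ (lexx t0) tT.
    have acr' : abs_continuous t0 T (fun t => (r t ^+ 2)^-1).
      apply: abs_continuousV; first exact: abs_continuousM.
      by move=> t /andP[tt _]; rewrite exprn_gt0 ?r0.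
    have [M HM] := abs_continuous_bounded (abs_continuousM ach acr').
    apply: (@integral_itvcy_lt_pinfty _ (fun t => h t / r t ^+ 2) q t0 T M
      (2 * lambdaN * e)) => //.
    - by rewrite !mulr_gt0.
    - by move=> t tt; rewrite ltW// mulr_gt0 ?h0 ?invr_gt0 ?exprn_gt0 ?r0.
    - by move=> t /HM; exact/le_trans/ler_norm.
    - by move=> t Tt; apply: q0; exact: le_trans Tt.
    - by move=> b; exact: acq.
    apply: (@filterS _ _ aefilter _ _ _ q') => t H Tt.
    have tt := le_trans tT (ltW Tt).
    have qt := H Tt; split; first by have [] := qt.
    rewrite derive1E derive_val lerN2 [leRHS]mulrC.
    rewrite (_ : 2 * lambdaN * e * _ = e * (2 * lambdaN * (h t / r t ^+ 2))); last by ring.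
    by rewrite ler_pM2r ?rate_gt0// ltW// qe// ltW.
  apply/cvg_ballP => e e0.
  (* The squared error of each coordinate is at most [2 * q], which this choice keeps below or equal
     to [(e / 2) ^+ 2]; the half leaves room for the strict inequality in [ball]. *)
  have e20 : 0 < (e / 2) ^+ 2 / 2 by rewrite divr_gt0// exprn_gt0// divr_gt0.
  have [t1 Tt1 qt1] := qsmall _ e20.
  apply: filterS (nbhs_pinfty_ge (num_real t1)) => t t1t.
  split=> // i j; rewrite ord1.
  have Tt := le_trans Tt1 t1t; have tt := le_trans tT Tt.
  rewrite /ball/= distrC (@le_lt_trans _ _ (e / 2))//; last by lra.
  rewrite -(@ler_pXn2r _ 2)// ?nnegrE//; last by rewrite ltW// divr_gt0.
  rewrite real_normK ?num_real//.
  apply: (le_trans (sqr_hhatB_le hhd j (hnd _ tt) (ltW (p0 _ tt)))).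
  have := nq _ _ Tt1 t1t; rewrite /q -/(p t); move: qt1; rewrite /q; lra.
Qed.
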